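(* For all $m$ and $r$, the number of thick diagrams of size $m$ with $r$ rows equals the Delannoy number $d_{m-r-1,r-2}$, and the number of non-mixed diagrams of size $m$ with $r$ rows equals the number of order-consecutive partitions of $[m]$ into $r$ parts.
   Context: Lattice paths consist of unit north ($N$) and east ($E$) steps starting at $(0,0)$. A diagram is the set of unit squares between two lattice paths $P$ (lower) and $Q$ (upper) with the same endpoints $(0,0)$ and $(m',r)$, $P$ strictly below $Q$ except at the endpoints; it has $r$ rows and its size is the length of $P$ minus one. Writing $P=p_1\cdots p_n$, $Q=q_1\cdots q_n$: for each $a$ with $q_a=E$, $q_{a+1}=N$ let $(a_1,a_2)$ be the point where these steps meet, and for each $b$ with $p_{b-1}=N$, $p_b=E$ let $(b_1,b_2)$ be the point where these steps meet; the diagram is non-mixed if there is no such pair with $a_1<b_1$ and $a_2>b_2$. A diagram is thick if it is non-mixed and every horizontal or vertical segment joining a point of $P$ to a point of $Q$ through the interior of the diagram has length at least $2$. The Delannoy number $d_{i,j}$ ($i,j\ge0$) is the number of paths from $(0,0)$ to $(i,j)$ with steps $(1,0),(0,1),(1,1)$; $d_{i,j}=0$ if $i<0$ or $j<0$. A partition $\{S_1,\ldots,S_r\}$ of $[m]$ is order-consecutive if for some permutation $k_1,\ldots,k_r$ of $[r]$ every union $S_{k_1}\cup\cdots\cup S_{k_\ell}$, $\ell\in[r]$, is an interval of integers. *)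

(* Defs.v *)
From HB Require Import structures.
From mathcomp Require Import all_boot all_order all_algebra.
From mathcomp Require Import all_classical all_reals all_analysis.
Import Order.TTheory GRing.Theory Num.Theory.
Import numFieldNormedType.Exports.

Set Implicit Arguments.
Unset Strict Implicit.
Unset Printing Implicit Defensive.

(* A lattice path is the word of its steps: [true] is a north step N and
   [false] an east step E.  [(xpos w k, ypos w k)] is the lattice point reached
   after the first [k] steps. *)
Definition xpos (w : seq bool) (k : nat) : nat := count negb (take k w).
Definition ypos (w : seq bool) (k : nat) : nat := count id (take k w).

(* The steps before and after the [k]-th point are E, N (resp. N, E). *)
Definition EN_turn (w : seq bool) (k : nat) : bool :=
  [&& 0 < k, k < size w, ~~ nth false w k.-1 & nth false w k].
Definition NE_turn (w : seq bool) (k : nat) : bool :=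
  [&& 0 < k, k < size w, nth false w k.-1 & ~~ nth false w k].

Section Diagrams.
Variable n : nat.
Implicit Types P Q : n.-tuple bool.

(* [P] (lower) and [Q] (upper) have the same endpoints (0,0) and (n - r, r).
   The [k]-th points of [P] and [Q] lie on the antidiagonal x + y = k, so these
   paths meet only if they do so for the same [k]. *)
Definition bounds_diagram (r : nat) P Q : bool :=
  [&& ypos P n == r, ypos Q n == r &
      [forall k : 'I_n, (0 < k) ==> (ypos P k < ypos Q k)]].

(* [(i, j)] stands for the unit square [i, i+1] x [j, j+1].  It lies above [P]
   iff its lower right corner (i+1, j) does, and below [Q] iff its upper left
   corner (i, j+1) does; both corners are on the antidiagonal x + y = i+j+1. *)
Definition squares P Q : {set 'I_n * 'I_n} :=
  [set c : 'I_n * 'I_n |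
     (c.1 < xpos P (c.1 + c.2).+1) && (c.2 < ypos Q (c.1 + c.2).+1)].

Definition non_mixed P Q : bool :=
  ~~ [exists a : 'I_n, exists b : 'I_n,
       [&& EN_turn Q a, NE_turn P b,
           xpos Q a < xpos P b & ypos P b < ypos Q a]].

End Diagrams.

Section Thick.
Variable R : realType.
Local Open Scope ring_scope.
Local Open Scope classical_set_scope.

(* Each step is a unit axis-parallel segment, hence equal to the box spanned by
   its ends. *)
Definition on_path (w : seq bool) (z : R * R) : Prop :=
  exists k : nat, [/\ (k < size w)%N,
    (xpos w k)%:R <= z.1 <= (xpos w k.+1)%:R &
    (ypos w k)%:R <= z.2 <= (ypos w k.+1)%:R].

Definition region n (D : {set 'I_n * 'I_n}) : set (R * R) :=
  [set z | exists c : 'I_n * 'I_n, [/\ c \in D,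
     (c.1 : nat)%:R <= z.1 <= (c.1 : nat).+1%:R &
     (c.2 : nat)%:R <= z.2 <= (c.2 : nat).+1%:R]].

Definition segment_meets (A : set (R * R)) (p q : R * R) : Prop :=
  exists t : R, 0 <= t <= 1 /\
    A ((1 - t) * p.1 + t * q.1, (1 - t) * p.2 + t * q.2).

Definition thick n (P Q : n.-tuple bool) : Prop :=
  non_mixed P Q /\
  forall p q : R * R, on_path P p -> on_path Q q ->
    segment_meets (interior (region (squares P Q))) p q ->
    (p.2 = q.2 -> 2 <= `|p.1 - q.1|) /\ (p.1 = q.1 -> 2 <= `|p.2 - q.2|).

End Thick.

(* Diagrams of size [m] are bounded by paths of length [m + 1]. *)
Definition non_mixed_diagrams (m r : nat) : {set {set 'I_m.+1 * 'I_m.+1}} :=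
  [set squares w.1 w.2 | w : m.+1.-tuple bool * m.+1.-tuple bool
     & bounds_diagram r w.1 w.2 && non_mixed w.1 w.2].

Definition thick_diagrams (R : realType) (m r : nat) :
    {set {set 'I_m.+1 * 'I_m.+1}} :=
  [set squares w.1 w.2 | w : m.+1.-tuple bool * m.+1.-tuple bool
     & bounds_diagram r w.1 w.2 && `[< thick R w.1 w.2 >]].

(* The step [(a, b)] is the vector with these coordinates read as 0 or 1; the
   null step is excluded, so that a path to (i, j) has at most i + j steps. *)
Definition delannoy_path (i j : nat) (w : seq (bool * bool)) : bool :=
  [&& all (fun s => s.1 || s.2) w, count fst w == i & count snd w == j].

Definition delannoy (i j : int) : nat :=
  match i, j with
  | Posz a, Posz b =>
      \sum_(k < (a + b).+1)
         #|[set w : k.-tuple (bool * bool) | delannoy_path a b w]|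
  | _, _ => 0
  end.

(* [m] is represented by 'I_m = {0, ..., m-1}. *)
Definition interval_set (m : nat) (A : {set 'I_m}) : bool :=
  [forall i in A, forall k in A, forall j : 'I_m,
     (i <= j <= k)%N ==> (j \in A)].

Definition order_consecutive (m : nat) (S : {set {set 'I_m}}) : bool :=
  [exists s : #|S|.-tuple {set 'I_m},
     perm_eq s (enum S) &&
     [forall l : 'I_#|S|, interval_set (\bigcup_(A <- take l.+1 s) A)%SET]].

Definition order_consecutive_partitions (m r : nat) :
    {set {set {set 'I_m}}} :=
  [set S : {set {set 'I_m}} |
     [&& finset.partition S [set: 'I_m], #|S| == r & order_consecutive S]].

(* Main.v *)
Require Import Defs.
From mathcomp Require Import all_boot all_order all_algebra.
From mathcomp Require Import all_classical all_reals all_analysis.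
From mathcomp Require Import zify ring lra.

Set Implicit Arguments.
Unset Strict Implicit.
Unset Printing Implicit Defensive.

(* Write the lower path as E v N and the upper path as N u E, where the words u
   and v have the same length and the same number of steps N.  The diagram is
   non-mixed iff every EN turn of u is comparable, in a suitable mixture of weak
   and strict product orders, with every NE turn of v (this forces v to lie below
   u); it is thick iff moreover these comparisons are strict in both coordinates
   and the words u, v differ in their first and in their last steps, because a
   segment of length one across the diagram is a common step of u and v.
   Deleting the first column or the first row of the diagram, that is the first E
   or the first N of both words, yields recurrences for the two counts: those of
   the even coefficients of (1 + x + x^2)^(m-1) and of the Delannoy numbers.
   An order-consecutive partition is determined by the word over {0, 1, 2} whose
   letter at the gap between g and g + 1 is [g + 1 is the least element of its
   part] + [g is the greatest element of its part]; peeling off the outer parts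
   shows that all words with sum 2 (r - 1) occur, and these are counted by the
   same coefficient. *)

(** * Non-mixed pairs of words *)

(** Comparability of turns encodes two conditions at once. Being non-mixed forbids an EN turn of [u]
    to the upper left of an NE turn of [v], and the opposite position would put [v] above [u]. As
    the second condition is thus absorbed, steps can be deleted without following the paths. The
    obstacle is that deleting a column is not a bijection by itself. Deleting the first E of a word
    translates its EN turns, unless this E is isolated and a turn is lost. So cutting the pairs that
    start with N E and E misses the results (N N ..., [v]) in which [v] has an NE turn of height 1;
    exactly these are obtained from the pairs that start with N N and have such a turn. For thick
    pairs the isolated cases instead remove a row and a column together, which gives the diagonal
    term of the Delannoy recurrence. For partitions the obstacle is that the peeling order is not
    unique: one-sided outer parts at opposite ends can be peeled in either order. Hence the
    injectivity of the gap word rests on rearranging a layering so that a prescribed part is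
    outermost. *)

(* The coefficient of [x ^ k] in [(1 + x + x ^ 2) ^ n]. *)
Fixpoint trinomial (n k : nat) : nat :=
  if n isn't n'.+1 then k == 0
  else trinomial n' k + (if k is k'.+1 then trinomial n' k' else 0)
       + (if k is k'.+2 then trinomial n' k' else 0).

Definition shift (b : bool) (t : nat * nat) : nat * nat :=
  if b then (t.1, t.2.+1) else (t.1.+1, t.2).

Definition coord (b : bool) (t : nat * nat) : nat := if b then t.2 else t.1.

(* The points at which a step [c] is followed by a step [~~ c]: the EN turns for
   [c = false], the NE turns for [c = true]. *)
Fixpoint turns (c : bool) (w : seq bool) : seq (nat * nat) :=
  if w is b :: w' then
    (if (b == c) && (ohead w' == Some (~~ c)) then [:: shift b (0, 0)] else [::])
      ++ map (shift b) (turns c w')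
  else [::].

Fixpoint words (n k : nat) : seq (seq bool) :=
  match n, k with
  | 0, 0 => [:: [::]]
  | 0, _.+1 => [::]
  | n'.+1, 0 => map (cons false) (words n' 0)
  | n'.+1, k'.+1 => map (cons false) (words n' k) ++ map (cons true) (words n' k')
  end.

Lemma mem_words n k w : (w \in words n k) = (size w == n) && (count id w == k).
Proof.
elim: n k w => [|n IH] [|k] w /=.
- by rewrite inE; case: w.
- by rewrite in_nil; case: w.
- case: w => [|[] w] /=; first by apply/mapP => -[].
  + rewrite andbF; by apply/mapP => -[].
  + by rewrite mem_map ?IH ?add0n // => x y [].
- rewrite mem_cat; case: w => [|[] w] /=.
  + by apply/orP => -[] /mapP[].
  + rewrite [X in X || _](_ : _ = false); last by apply/mapP => -[].
    by rewrite mem_map ?IH //= => x y [].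
  + rewrite [X in _ || X](_ : _ = false); last by apply/mapP => -[].
    by rewrite mem_map ?IH ?orbF //= => x y [].
Qed.

Lemma uniq_words n k : uniq (words n k).
Proof.
have inj b : injective (cons b : seq bool -> seq bool) by move=> x y [].
elim: n k => [|n IH] [|k] //=; first by rewrite map_inj_uniq.
rewrite cat_uniq !map_inj_uniq // !IH /= andbT.
by apply/hasPn => _ /mapP[w _ ->]; apply/mapP => -[].
Qed.

Lemma sum_wordsS n k (F : seq bool -> nat) :
  \sum_(w <- words n.+1 k) F w =
    \sum_(w <- words n k) F (false :: w)
    + (if k is k'.+1 then \sum_(w <- words n k') F (true :: w) else 0).
Proof. by case: k => [|k]; rewrite /= ?big_cat !big_map ?addn0. Qed.

(** The inverse laws are required only under the predicates, because deleting a letter undoes its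
    insertion only on the words that are counted. *)
Lemma count_bij (T1 T2 : eqType) (s : seq T1) (t : seq T2)
    (P : pred T1) (Q : pred T2) (f : T2 -> T1) (g : T1 -> T2) :
    uniq s -> uniq t ->
    {in t, forall y, Q y -> [/\ f y \in s, P (f y) & g (f y) = y]} ->
    {in s, forall x, P x -> [/\ g x \in t, Q (g x) & f (g x) = x]} ->
  count P s = count Q t.
Proof.
move=> us ut ft gs; rewrite -!size_filter -(size_map f).
apply/perm_size/uniq_perm.
- exact: filter_uniq.
- rewrite map_inj_in_uniq ?filter_uniq // => x y.
  rewrite !mem_filter => /andP[Qx tx] /andP[Qy ty] e.
  by case: (ft x tx Qx) => _ _ <-; case: (ft y ty Qy) => _ _ <-; rewrite e.
- move=> x; rewrite mem_filter; apply/andP/mapP => [[Px sx]|[y]].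
  + by case: (gs x sx Px) => tx Qx ex; exists (g x); rewrite ?mem_filter ?Qx.
  + by rewrite mem_filter => /andP[Qy ty] ->; case: (ft y ty Qy).
Qed.

(** Doubles the first [c], which lengthens the first run of [c]; a word without [c] gets it at the
    end. This is the inverse of deleting a row or a column on one of the two paths. *)
Fixpoint ins (c : bool) (w : seq bool) : seq bool :=
  if w is b :: w' then if b == c then c :: w else b :: ins c w' else [:: c].

Lemma shiftC b c t : shift b (shift c t) = shift c (shift b t).
Proof. by case: t b c => x y [] []. Qed.

Lemma turns_neq c w : turns c (~~ c :: w) = map (shift (~~ c)) (turns c w).
Proof. by rewrite /=; case: c. Qed.

Lemma turns_eq c w : turns c (c :: c :: w) = map (shift c) (turns c (c :: w)).
Proof. by rewrite /= eqxx; case: c. Qed.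

Lemma turns_turn c w :
  turns c (c :: ~~ c :: w) = shift c (0, 0) :: map (shift c) (turns c (~~ c :: w)).
Proof. by rewrite [LHS]/= !eqxx. Qed.

(** Every turn of kind [c] comes after the first [c], so doubling that letter moves all of them
    alike. *)
Lemma turns_ins c w : turns c (ins c w) = map (shift c) (turns c w).
Proof.
elim: w => [|b w IH]; first by rewrite /= eqxx; case: c.
rewrite [ins c _]/=; case: (eqVneq b c) => [->|bc]; first exact: turns_eq.
have -> : b = ~~ c by case: (b) (c) bc => -[].
rewrite !turns_neq IH -!map_comp; apply: eq_map => t /=; exact: shiftC.
Qed.

Lemma turns_coord c w t : t \in turns c w ->
  0 < coord c t /\ coord (~~ c) t < count (pred1 (~~ c)) w.
Proof.
elim: w t => [|b w IH] t //=; rewrite mem_cat => /orP[|/mapP[t' /IH[h1 h2] ->]].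
  clear IH; case: ifP => // /andP[/eqP-> h]; rewrite inE => /eqP->.
  case: w h => [|b' w] //= /eqP[->]; case: c; rewrite //=; lia.
by clear IH; case: c b h1 h2 => -[] /=; case: t' => x y /=; lia.
Qed.

Lemma count_ins a c w : count a (ins c w) = a c + count a w.
Proof. by elim: w => //= b w IH; case: eqP => //= _; rewrite IH addnCA. Qed.

Lemma size_ins c w : size (ins c w) = (size w).+1.
Proof. by elim: w => //= b w IH; case: eqP => //= _; rewrite IH. Qed.

Lemma rem_ins c w : rem c (ins c w) = w.
Proof. by elim: w => [|b w IH] /=; case: eqP => //= h; rewrite ?eqxx ?h //; case: eqP => // _; rewrite IH. Qed.

(** Reinsertion fails only if the first [c] is followed by [~~ c], that is at a turn with
    [c]-coordinate 1. Each deletion further on is inverted by showing that such a turn would be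
    incomparable with some turn of the other word. *)
Lemma ins_rem c w : c \in w ->
  ins c (rem c w) = w \/ exists2 t, t \in turns c w & coord c t = 1.
Proof.
elim: w => [|b w IH] //; rewrite inE eq_sym; case: (eqVneq b c) => [->|bc] /=.
  rewrite eqxx => _; case: w {IH} => [|d w]; first by left.
  case: (eqVneq d c) => [->|dc]; first by left; rewrite /= eqxx.
  have -> : d = ~~ c by case: (d) (c) dc => -[].
  by right; exists (shift c (0, 0)); rewrite ?turns_turn ?inE ?eqxx //; case: c {dc}.
rewrite (negbTE bc) => /IH[h|[t tw ct]].
  by left; rewrite /= (negbTE bc) h.
right; exists (shift b t); first by rewrite mem_cat map_f ?orbT.
by case: (b) (c) bc ct => -[].
Qed.

(** The turn in question ends the first run. *)
Lemma turns_first c w : ~~ c \in w -> ohead w = Some c ->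
  exists2 t, t \in turns c w & coord (~~ c) t = 0.
Proof.
elim: w => [|b w IH] //= nw [eb]; move: nw; rewrite {b}eb inE; have -> : (~~ c == c) = false by case: (c).
rewrite /= => nw; rewrite eqxx /=.
case: w nw IH => [|d w] // nw IH; case: (eqVneq d c) => [dc|dc].
  case: IH => //=; first by rewrite dc.
  move=> t tw ct; exists (shift c t); first by rewrite mem_cat map_f ?orbT.
  by move: ct; case: (c).
have -> : d = ~~ c by case: (d) (c) dc => -[].
by exists (shift c (0, 0)); rewrite /= ?eqxx ?inE ?eqxx //; case: (c).
Qed.

(* An EN turn [U] of [u] is the turn [(U.1, U.2 + 1)] of N u E and an NE turn [V]
   of [v] is the turn [(V.1 + 1, V.2)] of E v N, whence the asymmetry. *)
Definition weak_cmp (U V : nat * nat) : bool :=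
  ((V.1 < U.1) && (V.2 <= U.2)) || ((U.1 <= V.1) && (U.2 < V.2)).
Definition strict_cmp (U V : nat * nat) : bool :=
  ((V.1 < U.1) && (V.2 < U.2)) || ((U.1 < V.1) && (U.2 < V.2)).

Notation EN := (turns false).
Notation NE := (turns true).

Definition good (u v : seq bool) := allrel weak_cmp (EN u) (NE v).
Definition sgood (u v : seq bool) := allrel strict_cmp (EN u) (NE v).

Lemma allrel_map_shift (r : rel (nat * nat)) b s t :
  (forall U V, r (shift b U) (shift b V) = r U V) ->
  allrel r (map (shift b) s) (map (shift b) t) = allrel r s t.
Proof.
move=> h; rewrite allrel_mapl allrel_mapr.
by apply: eq_allrel => U V; rewrite h.
Qed.

Lemma weak_shift b U V : weak_cmp (shift b U) (shift b V) = weak_cmp U V.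
Proof. by case: b. Qed.
Lemma strict_shift b U V : strict_cmp (shift b U) (shift b V) = strict_cmp U V.
Proof. by case: b. Qed.

Lemma EN_coord u U : U \in EN u -> 0 < U.1 /\ U.2 < count id u.
Proof. by move=> /turns_coord[/= h1]; rewrite (eq_count (a2 := id)) // => -[]. Qed.
Lemma NE_coord v V : V \in NE v -> 0 < V.2 /\ V.1 < count negb v.
Proof. by move=> /turns_coord[/= h1]; rewrite (eq_count (a2 := negb)) // => -[]. Qed.

Lemma EN_true u : EN (true :: u) = map (shift true) (EN u).
Proof. exact: (turns_neq false). Qed.
Lemma NE_false u : NE (false :: u) = map (shift false) (NE u).
Proof. exact: (turns_neq true). Qed.

(** A common first step translates all turns and may create one more, at distance 1 from the origin
    on an axis. The weak inequalities make this one comparable with every translated turn of the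
    other word. *)
Lemma good_same b u v : good (b :: u) (b :: v) = good u v.
Proof.
rewrite /good; case: b; [rewrite EN_true|rewrite NE_false].
  rewrite /= ; case: ifP => h; last by rewrite allrel_map_shift //; exact: weak_shift.
  rewrite cat1s allrel_consr allrel_map_shift; last exact: weak_shift.
  suff -> : all (weak_cmp^~ (shift true (0, 0))) [seq shift true i | i <- EN u] by [].
  by apply/allP => _ /mapP[[x y] /EN_coord[/= h1 h2] ->]; rewrite /weak_cmp /=; lia.
rewrite /=; case: ifP => h; last by rewrite allrel_map_shift //; exact: weak_shift.
rewrite cat1s allrel_consl allrel_map_shift; last exact: weak_shift.
suff -> : all (weak_cmp (shift false (0, 0))) [seq shift false i | i <- NE v] by [].
by apply/allP => _ /mapP[[x y] /NE_coord[/= h1 h2] ->]; rewrite /weak_cmp /=; lia.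
Qed.

Lemma count_negb (u : seq bool) : count negb u = size u - count id u.
Proof. by rewrite -(count_predC id) /= -[X in _ = X - _]addnC addnK. Qed.

Lemma has_mem b (u : seq bool) : 0 < count (pred1 b) u -> b \in u.
Proof. by rewrite -has_count has_pred1. Qed.

Lemma mem_true (u : seq bool) : 0 < count id u -> true \in u.
Proof. by move=> h; apply: has_mem; rewrite (eq_count (a2 := id)) // => -[]. Qed.
Lemma mem_false (u : seq bool) : count id u < size u -> false \in u.
Proof.
move=> h; apply: has_mem; rewrite (eq_count (a2 := negb)); last by case.
by rewrite count_negb subn_gt0.
Qed.

(** The first EN turn of one word lies on the horizontal axis, the first NE turn of the other on the
    vertical axis, and neither is the origin. *)
Lemma good_false_true u v : size u = size v -> count id u = (count id v).+1 ->
  good (false :: u) (true :: v) = false.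
Proof.
move=> s c; apply/negP => /allrelP h.
have /(_ _)[||U Uu /= U0] := @turns_first false (false :: u).
- by rewrite /= inE mem_true ?orbT // c.
- by [].
have /(_ _)[||V Vv /= V0] := @turns_first true (true :: v).
- rewrite /= inE mem_false ?orbT // -s; have := count_size id u; lia.
- by [].
by have := h _ _ Uu Vv; have /= [? ?] := EN_coord Uu; have /= [? ?] := NE_coord Vv; rewrite /weak_cmp; lia.
Qed.

(** * Recurrences for non-mixed pairs *)

Definition npairs n k := \sum_(u <- words n k) count (good u) (words n k).
(* [kpairs] counts the pairs that start with different steps, these steps being
   removed; it accounts for the odd coefficients of [(1 + x + x ^ 2) ^ n]. *)
Definition kpairs n k :=
  \sum_(u <- words n k) count (fun v => good (true :: u) (false :: v)) (words n k.+1).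

Lemma count_wordsS n k (P : pred (seq bool)) :
  count P (words n.+1 k) =
    count (fun w => P (false :: w)) (words n k)
    + (if k is k'.+1 then count (fun w => P (true :: w)) (words n k') else 0).
Proof. by case: k => [|k]; rewrite /= ?count_cat !count_map ?addn0. Qed.

Lemma npairsS n k : npairs n.+1 k.+1 = npairs n k.+1 + kpairs n k + npairs n k.
Proof.
rewrite /npairs sum_wordsS -addnA; congr (_ + _).
  apply: eq_big_seq => u; rewrite mem_words => /andP[/eqP su /eqP cu].
  rewrite count_wordsS [X in _ + X = _](_ : _ = 0) ?addn0.
    by apply: eq_count => v; rewrite good_same.
  apply/eqP; rewrite -leqn0 leqNgt -has_count; apply/hasPn => v.
  rewrite mem_words => /andP[/eqP sv /eqP cv].
  by rewrite good_false_true // ?su ?cu ?cv.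
rewrite /kpairs -big_split /=; apply: eq_bigr => u _.
rewrite count_cat !count_map; congr (_ + _); apply: eq_count => v; exact: good_same.
Qed.

Lemma npairs0 n : npairs n.+1 0 = npairs n 0.
Proof.
rewrite /npairs sum_wordsS addn0; apply: eq_bigr => u _.
rewrite count_wordsS addn0; apply: eq_count => v; exact: good_same.
Qed.

Lemma exchange_count (S T : eqType) (s : seq S) (t : seq T) (P : S -> T -> bool) :
  \sum_(x <- s) count (P x) t = \sum_(y <- t) count (P^~ y) s.
Proof.
under eq_bigr do rewrite -sum1_count big_mkcond.
rewrite exchange_big /=; apply: eq_bigr => y _.
by rewrite -sum1_count -big_mkcond.
Qed.

(* If [v] has such a turn, or if [u] starts with E, the first column of the
   diagram of (N u, E v) can be deleted; otherwise its first row can. *)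
Definition low_turn (v : seq bool) := has (fun V => V.2 <= 1) (NE v).

Lemma count_split (T : Type) (P Q : pred T) s :
  count P s = count (fun x => P x && Q x) s + count (fun x => P x && ~~ Q x) s.
Proof. by elim: s => //= x s ->; case: (P x); case: (Q x) => /=; lia. Qed.

(** Both words lose their first E. If [u] starts with N, the first word also loses its turn (1, 1),
    and the turns of [false :: v] that are comparable with it are those of height at least 2. *)
Lemma good_cut_column u v :
  good (true :: false :: u) (false :: v)
    = good (true :: u) v && ~~ ((ohead u == Some true) && low_turn v).
Proof.
rewrite /good !EN_true NE_false /=.
rewrite map_cat allrel_catl -map_comp (eq_map (shiftC true false)) map_comp.
rewrite allrel_map_shift; last exact: weak_shift.
rewrite andbC; congr (_ && _); case: eqP => //= _.
rewrite allrel1l all_map /low_turn -all_predC; apply: eq_all => -[x y] /=.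
by rewrite /weak_cmp /=; lia.
Qed.

Lemma good_insE u v : good (ins false u) (false :: v) = good u v.
Proof. by rewrite /good turns_ins NE_false allrel_map_shift //; exact: weak_shift. Qed.
Lemma good_insN u v : good (true :: u) (ins true v) = good u v.
Proof. by rewrite /good turns_ins EN_true allrel_map_shift //; exact: weak_shift. Qed.

Lemma low_turn_insN v : low_turn (ins true v) = false.
Proof.
apply/negbTE/hasPn => V; rewrite turns_ins => /mapP[[x y] /NE_coord[/= h _] ->] /=; lia.
Qed.

Lemma ins_words n k b w :
  (ins b w \in words n.+1 (b + k)) = (w \in words n k).
Proof. by rewrite !mem_words size_ins count_ins eqSS eqn_add2l. Qed.

Lemma low_turn_count n k v : v \in words n k -> low_turn v -> k < n.
Proof.
rewrite mem_words => /andP[/eqP sv /eqP cv] /hasP[V /NE_coord[_ h] _].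
by rewrite count_negb sv cv in h; lia.
Qed.

Lemma low_turn_mem v : low_turn v -> exists2 V, V \in NE v & V.2 = 1.
Proof. by case/hasP=> -[x y] Vv /= h; exists (x, y) => //=; case: (NE_coord Vv) => /= h1 _; lia. Qed.

(** An EN turn of [[:: true, true & u]] with abscissa 1 has height at least 2 and is incomparable
    with the low turn of [false :: v]. So the first E of [u] is not followed by N, and deleting it
    is invertible. *)
Lemma count_low_column n k v : v \in words n.+2 k.+2 -> low_turn v ->
  count (fun u => good [:: true, true & u] (false :: v)) (words n.+1 k)
    = count (fun u => good [:: true, true & u] v) (words n k).
Proof.
move=> vw lv; apply: (count_bij (f := ins false) (g := rem false)); try exact: uniq_words.
  move=> u uw h; rewrite (ins_words _ _ false) uw rem_ins; split=> //.
  by have := good_insE [:: true, true & u] v; rewrite /= h.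
move=> u uw h.
have fu : false \in u.
  move: uw; rewrite mem_words => /andP[/eqP su /eqP cu]; apply: mem_false.
  by have := low_turn_count vw lv; rewrite su cu; lia.
have e : ins false (rem false u) = u.
  have [//|[[x1 x2] Uu /= U1]] := ins_rem fu.
  have [[y1 y2] Vv /= V2] := low_turn_mem lv.
  have : weak_cmp (shift true (shift true (x1, x2))) (shift false (y1, y2)).
    by move/allrelP: h; apply; rewrite ?EN_true ?NE_false ?map_f.
  by rewrite /weak_cmp /=; lia.
split=> //; first by rewrite -(ins_words _ _ false) e.
by move: h; rewrite -{1}e; have := good_insE [:: true, true & rem false u] v; rewrite /= => ->.
Qed.

(** Without a low turn, the first N of [v] is not followed by E and can be deleted; conversely a
    lengthened first run of N leaves no low turn. *)
Lemma count_high_row n k u :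
  count (fun v => good [:: true, true & u] (false :: v) && ~~ low_turn v) (words n.+1 k.+2)
    = count (fun v => good (true :: u) (false :: v)) (words n k.+1).
Proof.
apply: (count_bij (f := ins true) (g := rem true)); try exact: uniq_words.
  move=> v vw h; rewrite (ins_words _ _ true) vw rem_ins low_turn_insN andbT; split=> //.
  by have := good_insN (true :: u) (false :: v); rewrite /= h.
move=> v vw /andP[h lv].
have e : ins true (rem true v) = v.
  have tv : true \in v.
    by move: vw; rewrite mem_words => /andP[_ /eqP cv]; apply: mem_true; rewrite cv.
  have [//|[V Vv /= V2]] := ins_rem tv.
  by case/hasP: lv; exists V; rewrite ?V2.
split=> //; first by rewrite -(ins_words _ _ true) e.
by move: h; rewrite -{1}e; have := good_insN (true :: u) (false :: rem true v); rewrite /= => ->.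
Qed.

(** Cutting the column of the pairs that start with N E and E gives all pairs of the first two terms
    except those satisfying [low]. The pairs that start with N N and have a low turn are cut to
    exactly these exceptions, and the remaining ones lose their first row, which gives the third
    term. *)
Lemma kpairsS n k :
  kpairs n.+1 k = npairs n k + kpairs n k + (if k is k'.+1 then kpairs n k' else 0).
Proof.
have -> : npairs n k + kpairs n k =
    \sum_(u <- words n k) count (good (true :: u)) (words n.+1 k.+1).
  rewrite /npairs /kpairs -big_split /=; apply: eq_bigr => u _.
  rewrite count_cat !count_map addnC; congr (_ + _).
  by apply: eq_count => v /=; rewrite good_same.
rewrite {1}/kpairs sum_wordsS.
under eq_bigr do under eq_count do rewrite good_cut_column.
pose low u v := (ohead u == Some true) && low_turn v.
have -> : \sum_(u <- words n k) count (good (true :: u)) (words n.+1 k.+1) =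
    \sum_(u <- words n k) count (fun v => good (true :: u) v && low u v) (words n.+1 k.+1) +
    \sum_(u <- words n k) count (fun v => good (true :: u) v && ~~ low u v) (words n.+1 k.+1).
  by rewrite -big_split; apply: eq_bigr => u _ /=; exact: count_split.
rewrite [in RHS]addnAC [RHS]addnC; congr (_ + _).
case: k => [|k].
  rewrite addn0 big_seq big1 // => u; rewrite mem_words => /andP[_ /eqP cu].
  apply/eqP; rewrite -leqn0 leqNgt -has_count; apply/hasPn => v _.
  by rewrite /low; case: u cu => [|[] u] //= _; rewrite andbF.
rewrite [X in _ = X + _](_ : _ = \sum_(u <- words n k)
    count (fun v => good [:: true, true & u] (false :: v) && low_turn v) (words n.+1 k.+2)).
  rewrite /kpairs -big_split; apply: eq_bigr => u _ /=.
  by rewrite (count_split _ low_turn) count_high_row.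
case: n => [|n]; first by case: k => [|k]; rewrite /= ?big_nil ?big_seq1.
(* No word starting with E satisfies [low]; only the words starting with N remain to be matched. *)
rewrite sum_wordsS [X in X + _]big1 ?add0n.
  rewrite exchange_count [RHS]exchange_count; apply: eq_big_seq => v vw.
  case: (boolP (low_turn v)) => lv.
    transitivity (count (fun u => good [:: true, true & u] v) (words n k)).
      by apply: eq_count => u; rewrite /low lv /= andbT.
    by rewrite -(count_low_column vw lv); apply: eq_count => u; rewrite /= andbT.
  by rewrite !(@eq_count _ _ pred0) ?count_pred0 // => u /=; rewrite ?/low ?(negbTE lv) ?andbF.
move=> u _; apply/eqP; rewrite -leqn0 leqNgt -has_count; apply/hasPn => v _.
by rewrite andbF.
Qed.

Lemma kpairs0 k : kpairs 0 k = 0.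
Proof. by rewrite /kpairs; case: k => [|k] /=; rewrite ?big_nil ?big_seq1. Qed.

Lemma npairs_trinomial n k : npairs n k = trinomial n k.*2.
Proof.
suff [] : npairs n k = trinomial n k.*2 /\ kpairs n k = trinomial n k.*2.+1 by [].
elim: n k => [|n IH] k.
  rewrite kpairs0; split=> //; rewrite /npairs.
  by case: k => [|k]; rewrite /= ?big_nil ?big_seq1.
have nIH j := proj1 (IH j); have kIH j := proj2 (IH j).
split; last by rewrite kpairsS nIH kIH; case: k => [|k] /=; rewrite ?kIH /= ; lia.
case: k => [|k]; first by rewrite npairs0 nIH /=; lia.
by rewrite npairsS !nIH kIH doubleS /=; lia.
Qed.

(** * Thick pairs and Delannoy numbers *)

Lemma count_words0 n k (P : pred (seq bool)) :
  {in words n k, forall w, ~~ P w} -> count P (words n k) = 0.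
Proof. by move=> h; apply/eqP; rewrite -leqn0 leqNgt -has_count; apply/hasPn. Qed.

Lemma last_ins b c w : c \in w -> last b (ins c w) = last b w.
Proof.
elim: w b => [|d w IH] b //; rewrite inE eq_sym /=; case: (eqVneq d c) => [->|dc] //=.
exact: IH.
Qed.

Lemma last_mem (b : bool) (w : seq bool) : last b w != b -> last b w \in w.
Proof. by have := mem_last b w; rewrite inE => /orP[->|]. Qed.

Lemma last_false_lt n k u : u \in words n k -> ~~ last true u -> k < n.
Proof.
rewrite mem_words => /andP[/eqP<- /eqP<-] h.
have := @last_mem true u; rewrite (negbTE h) => /(_ isT).
by rewrite -has_pred1 has_count (eq_count (a1 := pred1 false) (a2 := negb)) ?count_negb ?subn_gt0 // => -[].
Qed.

(** As for [kpairs], the first steps N and E are removed. They serve as defaults in [last], so empty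
    words are rejected: a removed first step would then also be the last one, and of the wrong
    kind. *)
Definition prim (u v : seq bool) :=
  [&& sgood (true :: u) (false :: v), ~~ last true u & last false v].

Lemma sgood_insE u v : sgood (ins false u) (false :: v) = sgood u v.
Proof. by rewrite /sgood turns_ins NE_false allrel_map_shift //; exact: strict_shift. Qed.
Lemma sgood_insN u v : sgood (true :: u) (ins true v) = sgood u v.
Proof. by rewrite /sgood turns_ins EN_true allrel_map_shift //; exact: strict_shift. Qed.

Lemma prim_EE u v : prim [:: false, false & u] (false :: v) = prim (false :: u) v.
Proof. by rewrite /prim /=; have /= -> := sgood_insE [:: true, false & u] (false :: v). Qed.

Lemma prim_insN u v : true \in v -> prim (true :: u) (ins true v) = prim u v.
Proof.
move=> tv; rewrite /prim /= (last_ins _ tv).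
by have /= -> := sgood_insN (true :: u) (false :: v).
Qed.

Lemma prim_insE u v : false \in u -> prim (true :: ins false u) (false :: v) = prim (true :: u) v.
Proof.
move=> fu; rewrite /prim /= (last_ins _ fu).
by have /= -> := sgood_insE [:: true, true & u] (false :: v).
Qed.

Lemma sgoodP u v (h : sgood u v) U V : U \in EN u -> V \in NE v -> strict_cmp U V.
Proof. by move=> Uu Vv; move/allrelP: h; apply. Qed.

(** The first NE turn has abscissa 1 and positive height, the first EN turn has height 1 and
    abscissa at least 2, so they are not strictly comparable. For [k = 0] there is no EN turn, but
    then [v] has no N to end with. *)
Lemma prim_EE_N n k u v : u \in words n k -> v \in words n.+1 k ->
  prim [:: false, false & u] (true :: v) = false.
Proof.
rewrite !mem_words => /andP[/eqP su /eqP cu] /andP[/eqP sv /eqP cv].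
apply/negP => /and3P[h _ lv].
have kn : k <= n by rewrite -su -cu count_size.
have [|//|[x1 y1] V1 /= V0] := @turns_first true (true :: v).
  by rewrite /= inE mem_false ?orbT // cv sv.
have Vv : shift false (x1, y1) \in NE [:: false, true & v] by rewrite NE_false map_f.
case: k cu cv kn => [|k] cu cv kn.
  have : true \in v.
    by clear h V1 Vv; case: v sv cv lv => [|d v] //= _ _ <-; exact: mem_last.
  by rewrite -has_pred1 has_count (eq_count (a2 := id)) ?cv // => -[].
have [|//|[x2 y2] U1 /= U0] := @turns_first false (false :: u).
  by rewrite /= inE mem_true ?orbT // cu.
have Uu : shift true (shift false (x2, y2)) \in EN [:: true, false, false & u].
  by rewrite EN_true (turns_eq false) !map_f.
have := sgoodP h Uu Vv; have /= [? ?] := EN_coord U1; have /= [? ?] := NE_coord V1.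
rewrite /strict_cmp /=; lia.
Qed.

(** A row and a column are removed together. The turn (1, 1) that disappears from the first word is
    strictly to the lower left of all turns of the second, so it imposes nothing. *)
Lemma prim_ENinsN u v : true \in v ->
  prim [:: false, true & u] (false :: ins true v) = prim u v.
Proof.
move=> tv; rewrite /prim /= (last_ins _ tv); congr (_ && _).
rewrite /sgood EN_true (turns_turn false) !NE_false turns_ins.
rewrite -(map_comp _ _ (NE v)) (eq_map (shiftC false true)) map_comp.
rewrite -(map_comp (shift false) (shift true)) (eq_map (shiftC false true)) map_comp.
rewrite allrel_map_shift; last exact: strict_shift.
rewrite allrel_consl allrel_map_shift; last exact: strict_shift.
rewrite [X in X && _](_ : _ = true) ?NE_false //.
by apply/allP => _ /mapP[_ /mapP[[x y] /NE_coord[/= ? ?] ->] ->]; rewrite /strict_cmp /=; lia.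
Qed.

Lemma prim_insE_NE u v : false \in u ->
  prim (true :: ins false u) [:: true, false & v] = prim u v.
Proof.
move=> fu; rewrite /prim /= (last_ins _ fu); congr (_ && _).
rewrite /sgood [in LHS]NE_false (turns_turn true) !EN_true turns_ins.
rewrite -(map_comp _ _ (EN u)) (eq_map (shiftC true false)) map_comp.
rewrite -(map_comp (shift true) (shift false)) (eq_map (shiftC true false)) map_comp.
rewrite allrel_map_shift; last exact: strict_shift.
rewrite allrel_consr allrel_map_shift; last exact: strict_shift.
rewrite [X in X && _](_ : _ = true) //.
by apply/allP => _ /mapP[_ /mapP[[x y] /EN_coord[/= ? ?] ->] ->]; rewrite /strict_cmp /=; lia.
Qed.

(** * Recurrences for thick pairs *)

Definition tpairs n k := \sum_(u <- words n k) count (prim u) (words n k.+1).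
(** The pairs whose first row cannot be deleted; the complementary ones lose that row in
    [tpairsS]. *)
Definition cpairs n k := \sum_(u <- words n k)
  count (fun v => prim u v && ((ohead u == Some false) || low_turn v)) (words n k.+1).

Lemma count_prim_row n k u :
  count (fun v => prim (true :: u) v && ~~ low_turn v) (words n.+1 k.+2)
    = count (prim u) (words n k.+1).
Proof.
have tin m j w : w \in words m j.+1 -> true \in w.
  by rewrite mem_words => /andP[_ /eqP cw]; apply: mem_true; rewrite cw.
apply: (count_bij (f := ins true) (g := rem true)); try exact: uniq_words.
  move=> v vw h; rewrite (ins_words _ _ true) vw rem_ins low_turn_insN andbT; split=> //.
  by rewrite prim_insN // (tin _ _ _ vw).
move=> v vw /andP[h lv].
have e : ins true (rem true v) = v.
  have [//|[V Vv /= V2]] := ins_rem (tin _ _ _ vw).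
  by case/hasP: lv; exists V; rewrite ?V2.
have wr : rem true v \in words n k.+1 by rewrite -(ins_words _ _ true) e.
by split=> //; rewrite -(prim_insN u (tin _ _ _ wr)) e.
Qed.

Lemma tpairsS n k :
  tpairs n.+1 k = cpairs n.+1 k + (if k is k'.+1 then tpairs n k' else 0).
Proof.
rewrite /tpairs /cpairs !sum_wordsS -addnA; congr (_ + _).
  by apply: eq_bigr => u _; apply: eq_count => v /=; rewrite andbT.
case: k => [|k] //; rewrite -big_split; apply: eq_bigr => u _ /=.
by rewrite -(count_prim_row n k u) -count_split.
Qed.

(** Strict comparison with the turn (1, 1) of the first word forces the second one to start with E E
    and to have at least two letters in its first run of N. *)
Lemma count_prim_EN n k u : u \in words n k ->
  count (prim [:: false, true & u]) (words n.+2 k.+2) = count (prim u) (words n k.+1).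
Proof.
move=> uw.
have tin m j w : w \in words m j.+1 -> true \in w.
  by rewrite mem_words => /andP[_ /eqP cw]; apply: mem_true; rewrite cw.
rewrite count_wordsS [X in _ + X]count_words0 ?addn0; last first.
  move=> v vw; apply/negP => /and3P[h lu lv].
  (* The final E of [u] bounds [k]; hence [true :: v] also contains an E and has an NE turn, whose
     abscissa becomes 1 after the leading E. *)
  have kn := last_false_lt uw lu.
  have [|//|[x1 y1] V1 /= V0] := @turns_first true (true :: v).
    by move: vw; rewrite mem_words => /andP[/eqP sv /eqP cv]; rewrite /= inE mem_false ?orbT // sv cv; lia.
  have Vv : shift false (x1, y1) \in NE [:: false, true & v] by rewrite NE_false map_f.
  have Uu : (1, 1) \in EN [:: true, false, true & u].
    by rewrite EN_true (turns_turn false) inE eqxx.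
  by have := sgoodP h Uu Vv; rewrite /strict_cmp /=; lia.
apply: (count_bij (f := ins true) (g := rem true)); try exact: uniq_words.
  move=> v vw h; rewrite (ins_words _ _ true) vw rem_ins; split=> //.
  by rewrite prim_ENinsN // (tin _ _ _ vw).
move=> v vw h.
have e : ins true (rem true v) = v.
  have [//|[[x y] Vv /= V2]] := ins_rem (tin _ _ _ vw).
  have Vv' : shift false (shift false (x, y)) \in NE [:: false, false & v].
    by rewrite !NE_false !map_f.
  have Uu : (1, 1) \in EN [:: true, false, true & u].
    by rewrite EN_true (turns_turn false) inE eqxx.
  by case/and3P: h => h _ _; have := sgoodP h Uu Vv'; rewrite /strict_cmp /=; lia.
have wr : rem true v \in words n k.+1 by rewrite -(ins_words _ _ true) e.
by split=> //; rewrite -(prim_ENinsN u (tin _ _ _ wr)) e.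
Qed.

Lemma count_prim_NE n k v : v \in words n k.+1 ->
  count (fun u => prim (true :: u) [:: true, false & v]) (words n.+1 k)
    = count (prim^~ v) (words n k).
Proof.
rewrite mem_words => /andP[/eqP sv /eqP cv].
have kn : k < n by rewrite -sv -cv count_size.
have fin m w : k < m -> w \in words m k -> false \in w.
  by move=> km; rewrite mem_words => /andP[/eqP sw /eqP cw]; apply: mem_false; rewrite sw cw.
apply: (count_bij (f := ins false) (g := rem false)); try exact: uniq_words.
  move=> u uw h; rewrite (ins_words _ _ false) uw rem_ins; split=> //.
  by rewrite prim_insE_NE // (fin n).
move=> u uw h.
have e : ins false (rem false u) = u.
  have [//|[[x y] Uu /= U1]] := ins_rem (fin _ _ (ltnW kn : k < n.+1) uw).
  have Uu' : shift true (shift true (x, y)) \in EN [:: true, true & u].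
    by rewrite !EN_true !map_f.
  have Vv : (1, 1) \in NE [:: false, true, false & v].
    by rewrite NE_false (turns_turn true) inE eqxx.
  by case/and3P: h => h _ _; have := sgoodP h Uu' Vv; rewrite /strict_cmp /=; lia.
have wr : rem false u \in words n k by rewrite -(ins_words _ _ false) e.
by split=> //; rewrite -(prim_insE_NE v (fin _ _ kn wr)) e.
Qed.

(** As in [count_low_column], the low turn rules out an EN turn of abscissa 1, so the first E of [u]
    can be deleted. *)
Lemma count_prim_NN n k v : v \in words n.+1 k.+2 -> low_turn v ->
  count (fun u => prim (true :: u) (false :: v)) (words n.+1 k)
    = count (fun u => prim (true :: u) v) (words n k).
Proof.
move=> vw lv; have kn : k < n by have := low_turn_count vw lv; lia.
have fin m w : k < m -> w \in words m k -> false \in w.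
  by move=> km; rewrite mem_words => /andP[/eqP sw /eqP cw]; apply: mem_false; rewrite sw cw.
apply: (count_bij (f := ins false) (g := rem false)); try exact: uniq_words.
  move=> u uw h; rewrite (ins_words _ _ false) uw rem_ins; split=> //.
  by rewrite prim_insE // (fin n).
move=> u uw h.
have e : ins false (rem false u) = u.
  have [//|[[x y] Uu /= U1]] := ins_rem (fin _ _ (ltnW kn : k < n.+1) uw).
  have [[x2 y2] Vv /= V2] := low_turn_mem lv.
  have Uu' : shift true (shift true (x, y)) \in EN [:: true, true & u].
    by rewrite !EN_true !map_f.
  have Vv' : shift false (shift false (x2, y2)) \in NE [:: false, false & v].
    by rewrite !NE_false !map_f.
  by case/and3P: h => h _ _; have := sgoodP h Uu' Vv'; rewrite /strict_cmp /=; lia.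
have wr : rem false u \in words n k by rewrite -(ins_words _ _ false) e.
by split=> //; rewrite -(prim_insE v (fin _ _ kn wr)) e.
Qed.

Lemma low_turn_E v : low_turn (false :: v) = low_turn v.
Proof. by rewrite /low_turn NE_false has_map; apply: eq_has => -[]. Qed.
Lemma low_turn_NN v : low_turn [:: true, true & v] = false.
Proof. exact: (low_turn_insN (true :: v)). Qed.
Lemma low_turn_NE v : low_turn [:: true, false & v].
Proof. by rewrite /low_turn (turns_turn true). Qed.

Lemma cpairs_words n k : cpairs n.+1 k =
  \sum_(u <- words n k) count (prim (false :: u)) (words n.+1 k.+1)
  + (if k is k'.+1 then \sum_(u <- words n k')
       count (fun v => prim (true :: u) v && low_turn v) (words n.+1 k.+1) else 0).
Proof.
rewrite /cpairs sum_wordsS; congr (_ + _).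
by apply: eq_bigr => u _; apply: eq_count => v /=; rewrite andbT.
Qed.

(** A word with a low turn starts with E, where a column is cut, or with N E, where a row and a
    column are cut together. *)
Lemma count_prim_low n k :
  \sum_(u <- words n.+1 k) count (fun v => prim (true :: u) v && low_turn v) (words n.+2 k.+2)
  = \sum_(u <- words n k) count (fun v => prim (true :: u) v && low_turn v) (words n.+1 k.+2)
    + tpairs n k.
Proof.
have -> : tpairs n k = \sum_(u <- words n.+1 k)
    count (fun v => prim (true :: u) (true :: v) && low_turn (true :: v)) (words n.+1 k.+1).
  rewrite /tpairs exchange_count [RHS]exchange_count sum_wordsS [X in _ + X]big1 ?addn0.
    apply: eq_big_seq => v vw; rewrite -count_prim_NE //.
    by apply: eq_count => u; rewrite low_turn_NE andbT.
  move=> v _; apply: count_words0 => u _; by rewrite low_turn_NN andbF.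
have -> : \sum_(u <- words n k) count (fun v => prim (true :: u) v && low_turn v) (words n.+1 k.+2)
  = \sum_(u <- words n.+1 k)
      count (fun v => prim (true :: u) (false :: v) && low_turn (false :: v)) (words n.+1 k.+2).
  rewrite exchange_count [RHS]exchange_count; apply: eq_big_seq => v vw.
  case lv: (low_turn v); last first.
    by rewrite !(@eq_count _ _ pred0) ?count_pred0 // => u; rewrite ?low_turn_E ?lv andbF.
  transitivity (count (fun u => prim (true :: u) v) (words n k)).
    by apply: eq_count => u; rewrite ?lv andbT.
  rewrite -(count_prim_NN vw lv); apply: eq_count => u.
  by rewrite low_turn_E ?lv andbT.
by rewrite -big_split; apply: eq_bigr => u _; rewrite count_wordsS.
Qed.

(** The two copies of [tpairs n k'] come from first words starting with N E N and from second words
    starting with E N E. In the other cases only a column is removed. *)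
Lemma cpairsS n k : cpairs n.+2 k =
  cpairs n.+1 k + (if k is k'.+1 then (tpairs n k').*2 else 0).
Proof.
rewrite [in LHS]cpairs_words sum_wordsS cpairs_words.
have -> : \sum_(u <- words n k) count (prim [:: false, false & u]) (words n.+2 k.+1)
    = \sum_(u <- words n k) count (prim (false :: u)) (words n.+1 k.+1).
  apply: eq_big_seq => u uw; rewrite count_wordsS [X in _ + X]count_words0 ?addn0.
    by apply: eq_count => v; exact: prim_EE.
  by move=> v vw; rewrite (prim_EE_N uw vw).
case: k => [|k]; first by rewrite !addn0.
rewrite count_prim_low [X in _ + X + _](_ : _ = tpairs n k).
  by rewrite -addnn; lia.
by apply: eq_big_seq => u uw; rewrite count_prim_EN.
Qed.

Lemma tpairs0 k : tpairs 0 k = 0.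
Proof. by rewrite /tpairs; case: k => [|k] /=; rewrite ?big_nil ?big_seq1. Qed.

Lemma cpairs1 k : cpairs 1 k = (k == 0).
Proof.
rewrite cpairs_words; case: k => [|k]; first by rewrite /= !big_seq1.
by rewrite big_nil; case: k => [|k] /=; rewrite ?big_nil ?big_seq1.
Qed.

(** Eliminating [cpairs] by means of [tpairsS] uses up one of the two copies of [tpairs n k]; the
    other is the diagonal term of the Delannoy recurrence. *)
Lemma tpairsSS n k : tpairs n.+2 k.+1 = tpairs n.+1 k.+1 + tpairs n.+1 k + tpairs n k.
Proof. by rewrite tpairsS cpairsS [in RHS]tpairsS -addnn; lia. Qed.

Lemma tpairsS0 n : tpairs n.+1 0 = 1.
Proof.
rewrite tpairsS addn0; elim: n => [|n IH]; first by rewrite cpairs1.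
by rewrite cpairsS addn0.
Qed.

Lemma tpairs1 k : tpairs 1 k = (k == 0).
Proof. by rewrite tpairsS cpairs1; case: k => [|k]; rewrite ?tpairs0 ?addn0. Qed.

(** * Delannoy numbers, refined by the number of steps *)

Lemma card_tupleS (T : finType) n (P : pred (seq T)) :
  #|[set w : n.+1.-tuple T | P w]| = \sum_(x : T) #|[set w : n.-tuple T | P (x :: w)]|.
Proof.
rewrite cardsE -sum1_card big_mkcond /=.
rewrite (reindex (fun p : T * n.-tuple T => cons_tuple p.1 p.2)) /=; last first.
  exists (fun w => (thead w, [tuple of behead w])) => [[x w]|w] _ /=.
    by rewrite theadE; congr (_, _); apply: val_inj.
  by rewrite [RHS]tuple_eta.
under [RHS]eq_bigr do rewrite cardsE -sum1_card big_mkcond.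
by rewrite pair_big.
Qed.

Lemma card_tuple0 (T : finType) (P : pred (seq T)) :
  #|[set w : 0.-tuple T | P w]| = P [::].
Proof.
rewrite cardsE; case h: (P [::]).
  rewrite -[RHS](card_tuple 0 T); apply: eq_card => w; by rewrite tuple0 !inE.
by apply: eq_card0 => w; rewrite tuple0 inE.
Qed.

Definition delannoy_steps n i j := #|[set w : n.-tuple (bool * bool) | delannoy_path i j w]|.

Lemma delannoy_steps0 i j : delannoy_steps 0 i j = (i == 0) && (j == 0).
Proof. by rewrite /delannoy_steps card_tuple0 /delannoy_path /= ![0 == _]eq_sym. Qed.

Lemma delannoy_stepsS n i j : delannoy_steps n.+1 i j =
  (if i is i'.+1 then delannoy_steps n i' j else 0)
  + (if j is j'.+1 then delannoy_steps n i j' else 0)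
  + (if (i, j) is (i'.+1, j'.+1) then delannoy_steps n i' j' else 0).
Proof.
rewrite /delannoy_steps card_tupleS.
have step a b : #|[set w : n.-tuple (bool * bool) | delannoy_path i j ((a, b) :: w)]| =
    if [&& a || b, a <= i & b <= j] then delannoy_steps n (i - a) (j - b) else 0.
  case: ifP => [/and3P[ab ai bj]|h].
    apply: eq_card => w; rewrite !inE /delannoy_path /= ab /=.
    by congr [&& _, _ & _]; apply/eqP/eqP => e; lia.
  rewrite cardsE; apply: eq_card0 => w; rewrite inE /delannoy_path /=; apply/negP => /and3P[/andP[ab _] /eqP ei /eqP ej]; move: h.
  by rewrite ab -ei -ej !leq_addr.
rewrite -(pair_bigA _ (fun a b => #|[set w : n.-tuple (bool * bool) | delannoy_path i j ((a, b) :: w)]|)) /=.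
rewrite !big_bool /= !step /=.
case: i {step} => [|i]; case: j => [|j]; rewrite /= ?subn0 ?subn1 /= ?addn0 ?add0n //.
by rewrite -addnA addnC.
Qed.

Lemma delannoy_steps_gt n i j : i + j < n -> delannoy_steps n i j = 0.
Proof.
elim: n i j => // n IH i j h; rewrite delannoy_stepsS.
by case: i h => [|i] h; case: j h => [|j] h; rewrite ?IH //; lia.
Qed.

Definition delannoy_nat i j := \sum_(n < (i + j).+1) delannoy_steps n i j.

Lemma delannoy_nat_widen i j L : i + j < L ->
  delannoy_nat i j = \sum_(n < L) delannoy_steps n i j.
Proof.
move=> h; rewrite /delannoy_nat -!(big_mkord xpredT (fun n => delannoy_steps n i j)).
rewrite [RHS](@big_cat_nat _ _ _ (i + j).+1) //= [X in _ = _ + X](_ : _ = 0) ?addn0 //.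
rewrite big_nat_cond big1 // => k /andP[/andP[h1 _] _].
by rewrite delannoy_steps_gt.
Qed.

Lemma delannoy_nat00 : delannoy_nat 0 0 = 1.
Proof. by rewrite /delannoy_nat big_ord1 delannoy_steps0. Qed.

Lemma delannoy_natS i j : 0 < i + j -> delannoy_nat i j =
  (if i is i'.+1 then delannoy_nat i' j else 0)
  + (if j is j'.+1 then delannoy_nat i j' else 0)
  + (if (i, j) is (i'.+1, j'.+1) then delannoy_nat i' j' else 0).
Proof.
move=> ij; rewrite {1}/delannoy_nat big_ord_recl delannoy_steps0.
have -> : ((i == 0) && (j == 0) : nat) = 0 by case: i j ij => [|i] [|j].
rewrite add0n; under eq_bigr do rewrite lift0 delannoy_stepsS.
rewrite !big_split /=; congr (_ + _ + _).
- case: i ij => [|i] ij; first by rewrite big1.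
  by rewrite -delannoy_nat_widen //; lia.
- case: j ij => [|j] ij; first by rewrite big1.
  by rewrite -delannoy_nat_widen //; lia.
- case: i ij => [|i] ij; first by rewrite big1.
  case: j ij => [|j] ij; first by rewrite big1.
  by rewrite -delannoy_nat_widen //; lia.
Qed.

Lemma tpairs_gt n k : n <= k -> tpairs n k = 0.
Proof.
move=> nk; rewrite /tpairs big1 // => u _; apply: count_words0 => v.
by rewrite mem_words => /andP[/eqP sv /eqP cv]; have := count_size id v; rewrite sv cv; lia.
Qed.

Lemma tpairs_delannoy i j : tpairs (i + j).+1 j = delannoy_nat i j.
Proof.
have [n] := ubnP (i + j); elim: n i j => // n IH i j; rewrite ltnS => ij.
case: i ij => [|i]; case: j => [|j] ij.
- by rewrite tpairs1 delannoy_nat00.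
- rewrite delannoy_natS // addn0 -IH; last lia.
  by rewrite !add0n tpairsSS tpairs_gt // (tpairs_gt (n := j)) // addn0.
- rewrite delannoy_natS //= !addn0 -IH; last lia.
  by rewrite !addn0 !tpairsS0.
- rewrite delannoy_natS //= -!IH; try lia.
  by rewrite !addSn !addnS tpairsSS.
Qed.

(** * Diagrams and pairs of words *)

(** If the [k]-th point lies in a run of [c], take the end of this run; in a run of [~~ c], take its
    beginning. The two hypotheses make these ends genuine turns. *)
Lemma turns_around c w k :
    0 < count (pred1 c) (take k w) ->
    count (pred1 (~~ c)) (take k w) < count (pred1 (~~ c)) w ->
  exists t, [/\ t \in turns c w, count (pred1 c) (take k w) <= coord c t
              & coord (~~ c) t <= count (pred1 (~~ c)) (take k w)].
Proof.
elim: w k => [|b w IH] [|k] //= h1 h2.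
have [h|h] := posnP (count (pred1 c) (take k w)); last first.
  have [|[x y] [tw t1 t2]] := IH k h; first by rewrite ltn_add2l in h2.
  exists (shift b (x, y)); rewrite mem_cat map_f ?orbT //; split=> //.
    by case: (b) (c) t1 => -[] /=; lia.
  by case: (b) (c) t2 => -[] /=; lia.
have bc : b = c by case: eqP h1 => //; rewrite h.
rewrite h {}bc eqxx in h1 h2 *; have nc : (c == ~~ c) = false by case: (c).
rewrite nc !add0n in h2 *.
have [/eqP h0|h0] := boolP (ohead w == Some (~~ c)).
  exists (shift c (0, 0)); rewrite inE eqxx.
  by split=> //; case: (c).
have [||t tw t0] := @turns_first c w.
- by rewrite -has_pred1 has_count (leq_ltn_trans _ h2).
- clear IH h; case: w h2 h0 => [|d w] /=; first by rewrite ltn0.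
  by case: (d) (c) => -[].
have [t1 _] := turns_coord tw.
exists (shift c t); split; first by rewrite mem_cat map_f ?orbT.
  by case: (c) t1 => /=; lia.
by case: (c) t0 => /= ->.
Qed.

Lemma EN_around u k : 0 < xpos u k -> ypos u k < count id u ->
  exists U, [/\ U \in EN u, xpos u k <= U.1 & U.2 <= ypos u k].
Proof.
have e s : count (pred1 false) s = count negb s by apply: eq_count => -[].
have e' s : count (pred1 true) s = count id s by apply: eq_count => -[].
by rewrite /xpos /ypos -!e -!e'; exact: (@turns_around false).
Qed.

Lemma NE_around v k : 0 < ypos v k -> xpos v k < count negb v ->
  exists V, [/\ V \in NE v, V.1 <= xpos v k & ypos v k <= V.2].
Proof.
have e s : count (pred1 false) s = count negb s by apply: eq_count => -[].
have e' s : count (pred1 true) s = count id s by apply: eq_count => -[].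
rewrite /xpos /ypos -!e -!e' => h1 h2.
by have [V [? ? ?]] := @turns_around true v k h1 h2; exists V.
Qed.

Lemma mem_turns c w t : t \in turns c w <->
  exists k, [/\ k.+1 < size w, nth false w k = c, nth false w k.+1 = ~~ c
              & t = (xpos w k.+1, ypos w k.+1)].
Proof.
elim: w t => [|b w IH] t; first by split=> // -[k []].
rewrite [turns _ _]/= mem_cat; split.
  case/orP => [|/mapP[t' /IH[k [h1 h2 h3 ->]] ->]].
    case: ifP => // /andP[/eqP-> h]; rewrite inE => /eqP->.
    exists 0; case: w h {IH} => [|d w] //= /eqP[->]; split=> //.
    by rewrite /xpos /ypos /=; case: (c).
  exists k.+1; split=> //; rewrite /xpos /ypos /=; by case: (b).
case=> -[|k] [h1 h2 h3 ->].
  clear IH; case: w h1 h2 h3 => [|d w] //= _ h2 ->; rewrite -h2 /= !eqxx.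
  by rewrite inE /xpos /ypos /=; case: (b).
apply/orP; right; apply/mapP; exists (xpos w k.+1, ypos w k.+1).
  by apply/IH; exists k.
by rewrite /xpos /ypos /=; case: (b).
Qed.

Lemma xyposD w k : k <= size w -> xpos w k + ypos w k = k.
Proof.
move=> kw; rewrite /xpos /ypos addnC -[RHS](size_takel kw) -(count_predC id (take k w)).
by congr (_ + _); apply: eq_count => -[].
Qed.

Lemma yposS w k : k < size w -> ypos w k.+1 = ypos w k + nth false w k.
Proof. by move=> kw; rewrite /ypos (take_nth false kw) -cats1 count_cat /= addn0. Qed.
Lemma xposS w k : k < size w -> xpos w k.+1 = xpos w k + ~~ nth false w k.
Proof. by move=> kw; rewrite /xpos (take_nth false kw) -cats1 count_cat /= addn0. Qed.

Lemma ypos_le w k l : k <= l -> ypos w k <= ypos w l.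
Proof.
move=> kl; rewrite /ypos -(subnKC kl) takeD count_cat; exact: leq_addr.
Qed.
Lemma xpos_le w k l : k <= l -> xpos w k <= xpos w l.
Proof.
move=> kl; rewrite /xpos -(subnKC kl) takeD count_cat; exact: leq_addr.
Qed.
Lemma ypos_size w : ypos w (size w) = count id w.
Proof. by rewrite /ypos take_size. Qed.

Section Pair.
Variables (u v : seq bool).
Hypotheses (suv : size u = size v) (cuv : count id u = count id v).

Definition below := forall k, k <= size u -> ypos v k <= ypos u k.
(** The non-mixed condition in the coordinates of the inner words: the outer steps N of [upper] and
    E of [lower] turn its strict inequalities into weak ones. *)
Definition apart := all (fun U => all (fun V => ~~ ((U.1 <= V.1) && (V.2 <= U.2))) (NE v)) (EN u).

(** If [v] were above [u] somewhere, [u] would have an EN turn to the lower right of its point there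
    and [v] an NE turn to the upper left of its own, and these are incomparable. *)
Lemma good_below : good u v -> below.
Proof.
move=> g k ku; rewrite leqNgt; apply/negP => lt.
have kv : k <= size v by rewrite -suv.
have xu := xyposD ku; have xv := xyposD kv.
have nuv : count negb u = count negb v by rewrite !count_negb suv cuv.
have [||[a b] [Uu /= U1 U2]] := @EN_around u k; first by lia.
  by rewrite cuv -ypos_size (leq_trans lt) // ypos_le.
have [||[c d] [Vv /= V1 V2]] := @NE_around v k; first by lia.
  have := @xpos_le u _ _ ku; rewrite -nuv {2}/xpos take_size; lia.
move/allrelP: g => /(_ _ _ Uu Vv); rewrite /weak_cmp /=; lia.
Qed.

Lemma good_apart : good u v -> apart.
Proof.
clear suv cuv.
move=> /allrelP g; apply/allP => U Uu; apply/allP => V Vv; move: (g _ _ Uu Vv).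
by rewrite /weak_cmp; case: U V {Uu Vv} => a b [c d] /=; lia.
Qed.

(** Incomparable turns are in one of two opposite positions: [apart] excludes one, and the other
    would put [v] above [u] where [u] turns. *)
Lemma below_apart_good : below -> apart -> good u v.
Proof.
clear cuv.
move=> bel ap; apply/allrelP => -[a b] [c d] Uu Vv.
have /= := allP (allP ap _ Uu) _ Vv; rewrite /weak_cmp /=.
have [k [ku _ _ [ea eb]]] := (mem_turns _ _ _).1 Uu.
have [l [lv _ _ [ec ed]]] := (mem_turns _ _ _).1 Vv.
rewrite -suv in lv.
have xk := xyposD (ltnW ku); have xl := @xyposD v l.+1; rewrite -suv in xl; have {}xl := xl (ltnW lv).
have xk' := @xyposD v k.+1; rewrite -suv in xk'; have {}xk' := xk' (ltnW ku).
have bk := bel _ (ltnW ku).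
have [lk|kl] := leqP l k.
  have := @ypos_le v l.+1 k.+1 lk; lia.
have := @xpos_le v k.+1 l.+1 (ltnW kl); lia.
Qed.

Definition tprim := [&& sgood u v, ohead u == Some true, ohead v == Some false,
  ~~ last true u & last false v].

Definition no_common_step := forall k, k < size u -> ypos u k = ypos v k ->
  nth false u k != nth false v k.

Lemma sgood_good : sgood u v -> good u v.
Proof.
clear suv cuv.
move=> /allrelP g; apply/allrelP => U V Uu Vv; move: (g _ _ Uu Vv).
by rewrite /weak_cmp /strict_cmp; case: U V {Uu Vv} => a b [c d] /=; lia.
Qed.

(** If a weak comparison has an equal coordinate, the step just before the later of the two turns is
    common to both words, since [v] stays below [u]. *)
Lemma no_common_tprim : 0 < size u -> good u v -> no_common_step -> tprim.
Proof.
move=> u0 g nc; have bel := good_below g.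
have ends : ~~ last true u && last false v.
  have k1 : (size u).-1 < size u by rewrite prednK.
  have k1v : (size u).-1 < size v by rewrite -suv.
  rewrite -!nth_last -suv (set_nth_default false true k1).
  have := nc _ k1; have := bel _ (ltnW k1); have := yposS k1; have := yposS k1v.
  rewrite prednK // {1}suv !ypos_size -cuv.
  by case: nth; case: nth => /=; lia.
have v0 : 0 < size v by rewrite -suv.
have starts : nth false u 0 && ~~ nth false v 0.
  have := nc _ u0; have := bel _ u0; rewrite !yposS // /ypos !take0.
  by case: (nth false u 0); case: (nth false v 0) => //= _ /(_ erefl).
apply/and5P; split.
- apply/allrelP => -[a b] [c d] Uu Vv; move/allrelP: g => /(_ _ _ Uu Vv).
  have [k [ku uk uk1 [ea eb]]] := (mem_turns _ _ _).1 Uu.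
  have [l [lv vl vl1 [ec ed]]] := (mem_turns _ _ _).1 Vv.
  have lu : l.+1 < size u by rewrite suv.
  have kv : k.+1 < size v by rewrite -suv.
  have xU := xyposD (ltnW ku); have xV := xyposD (ltnW lv); subst a b c d.
  have [uS vS] := (yposS (ltnW ku), yposS (ltnW kv)); rewrite uk addn0 in uS.
  have [uT vT] := (xposS (ltnW lu), xposS (ltnW lv)); rewrite vl addn0 in vT.
  move=> /orP[/andP[/= ca db]|/andP[/= ac bd]]; apply/orP; [left|right]; rewrite /= ?ca ?bd ?andbT /=.
  - rewrite ltn_neqAle db andbT; apply/eqP => e.
    have lk : l < k by clear -xU xV ca e; lia.
    have h1 := @ypos_le v l.+1 k lk; have h2 := bel _ (ltnW ku).
    have := nc _ (ltnW ku); rewrite uk.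
    case: (nth false v k) vS => /= vS; first by clear -h1 h2 e vS; lia.
    by move=> h; suff /h : ypos u k = ypos v k by []; clear -h1 h2 e uS vS; lia.
  - rewrite ltn_neqAle ac andbT; apply/eqP => e.
    have kl : k < l by clear -xU xV bd e; lia.
    have h1 := @xpos_le u k.+1 l kl; have h2 := bel _ (ltnW lu).
    have xu := xyposD (ltnW lu); have xu' := xyposD (ltnW (ltnW lu)).
    have xv' := xyposD (ltnW (ltnW lv)).
    have := nc _ (ltnW lu); rewrite vl.
    case: (nth false u l) uT => /= uT; last by clear -h1 h2 e uT xu xV; lia.
    by move=> h; suff /h : ypos u l = ypos v l by []; clear -h1 h2 e uT vT xu xu' xV xv'; lia.
- by case: (u) starts => [|[]].
- by case/andP: starts => _; case: (v) v0 => [|[]].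
- by case/andP: ends.
- by case/andP: ends.
Qed.

(** At an interior contact point, an EN turn of [u] to its lower right and an NE turn of [v] to its
    upper left are not strictly comparable. The prescribed first and last steps ensure that both
    turns exist. *)
Lemma tprim_below : tprim -> forall k, 0 < k < size u -> ypos v k < ypos u k.
Proof.
case/and5P=> sg hu hv lu lv k /andP[k0 ks].
have ks' : k <= size v by rewrite -suv ltnW.
have bel := good_below (sgood_good sg) (ltnW ks).
rewrite ltn_neqAle bel andbT; apply/eqP => e.
have xu := xyposD (ltnW ks); have xv := xyposD ks'.
have u0 : 0 < size u by lia.
have v0 : 0 < size v by rewrite -suv.
have nuv : count negb u = count negb v by rewrite !count_negb suv cuv.
have y1 : 0 < ypos u 1 by rewrite yposS // /ypos take0; case: (u) hu => [|[]].
have x1 : 0 < xpos v 1 by rewrite xposS // /xpos take0; case: (v) hv => [|[]].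
have y2 := @ypos_le u _ _ k0; have x2 := @xpos_le v _ _ k0.
have k1 : (size u).-1 < size u by rewrite prednK.
have k1v : (size u).-1 < size v by rewrite -suv.
have kk : k <= (size u).-1 by rewrite -ltnS prednK.
have y3 := @ypos_le v _ _ kk; have x3 := @xpos_le u _ _ kk.
have y4 : ypos v (size u).-1 < count id v.
  have := yposS k1v; rewrite prednK // {1}suv ypos_size suv nth_last lv; lia.
have x4 : xpos u (size u).-1 < count negb u.
  have := xposS k1; rewrite prednK // {1}/xpos take_size (set_nth_default true) // nth_last lu; lia.
have [||[a b] [Uu /= U1 U2]] := @EN_around u k; try lia.
have [||[c d] [Vv /= V1 V2]] := @NE_around v k; try lia.
by have := sgoodP sg Uu Vv; rewrite /strict_cmp /=; lia.
Qed.
End Pair.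

Lemma turns_rcons c w : turns c (rcons w c) = turns c w.
Proof.
elim: w => [|b w IH] /=; first by case: c.
rewrite IH; case: w {IH} => [|d w] //=.
have -> : (Some c == Some (~~ c)) = false by case: c.
by rewrite !andbF.
Qed.

Lemma mem_EN w t : t \in EN w <-> exists2 k, EN_turn w k & t = (xpos w k, ypos w k).
Proof.
split=> [/mem_turns[k [h1 h2 h3 ->]]|[[|k] /and4P[h0 h1 h2 h3] ->]] //.
  by exists k.+1 => //; rewrite /EN_turn h1 /= h2 h3.
by apply/mem_turns; exists k; split=> //; exact/negbTE.
Qed.

Lemma mem_NE w t : t \in NE w <-> exists2 k, NE_turn w k & t = (xpos w k, ypos w k).
Proof.
split=> [/mem_turns[k [h1 h2 h3 ->]]|[[|k] /and4P[h0 h1 h2 h3] ->]] //.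
  by exists k.+1 => //; rewrite /NE_turn h1 /= h2 h3.
by apply/mem_turns; exists k; split=> //; exact/negbTE.
Qed.

Lemma ypos_cons b w k : ypos (b :: w) k.+1 = b + ypos w k.
Proof. by []. Qed.
Lemma ypos_rcons w b k : k <= size w -> ypos (rcons w b) k = ypos w k.
Proof. by move=> kw; rewrite /ypos -cats1 takel_cat. Qed.

(** * The outer steps of the bounding paths *)

Section Outline.
Variable N : nat.
Implicit Types (u v : N.-tuple bool).

Definition lower v : N.+2.-tuple bool := [tuple of false :: rcons v true].
Definition upper u : N.+2.-tuple bool := [tuple of true :: rcons u false].

Lemma non_mixed_apart u v : non_mixed (lower v) (upper u) = apart u v.
Proof.
have eU : EN (upper u) = map (shift true) (EN u) by rewrite EN_true turns_rcons.
have eV : NE (lower v) = map (shift false) (NE v) by rewrite NE_false turns_rcons.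
apply/idP/idP => [nm|ap].
  apply/allP => U Uu; apply/allP => V Vv; apply/negP => /andP[h1 h2].
  have /mem_EN[a ta ea] : shift true U \in EN (upper u) by rewrite eU map_f.
  have /mem_NE[b tb eb] : shift false V \in NE (lower v) by rewrite eV map_f.
  have an : a < N.+2 by case/and4P: ta => _; rewrite size_tuple.
  have bn : b < N.+2 by case/and4P: tb => _; rewrite size_tuple.
  case/existsP: nm; exists (Ordinal an); apply/existsP; exists (Ordinal bn).
  case: ea eb => <- <- [<- <-]; rewrite /= ta tb /=; lia.
apply/negP => /existsP[a /existsP[b /and4P[ta tb h1 h2]]].
have : (xpos (upper u) a, ypos (upper u) a) \in EN (upper u) by apply/mem_EN; exists a.
have : (xpos (lower v) b, ypos (lower v) b) \in NE (lower v) by apply/mem_NE; exists b.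
rewrite eU eV => /mapP[[c d] Vv [ec ed]] /mapP[[e f] Uu [ee ef]].
by have /negP[] := allP (allP ap _ Uu) _ Vv; rewrite /= -ee -ed -[_ <= c]ltnS -[_ <= f]ltnS -ec -ef h1 h2.
Qed.

Lemma bounds_lower_upper u v r : bounds_diagram r (lower v) (upper u) <->
  [/\ (count id u).+1 = r, (count id v).+1 = r & below u v].
Proof.
have yl k : k <= N -> ypos (lower v) k.+1 = ypos v k.
  by move=> kN; rewrite ypos_cons ypos_rcons // size_tuple.
have yu k : k <= N -> ypos (upper u) k.+1 = (ypos u k).+1.
  by move=> kN; rewrite ypos_cons ypos_rcons // size_tuple.
have yle : ypos (lower v) N.+2 = (count id v).+1.
  by rewrite /ypos take_oversize ?size_tuple //= -cats1 count_cat /= add0n addn1.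
have yue : ypos (upper u) N.+2 = (count id u).+1.
  by rewrite /ypos take_oversize ?size_tuple //= -cats1 count_cat /= !addn0.
split.
  case/and3P=> /eqP h1 /eqP h2 /forallP h3; split; rewrite -?yue -?yle //.
  move=> k; rewrite size_tuple => kN; have kn : k.+1 < N.+2 by [].
  by have := h3 (Ordinal kn); rewrite /= yl // yu.
case=> h1 h2 h3; apply/and3P; split; rewrite ?yle ?yue ?h1 ?h2 //.
apply/forallP => -[[|k] kn] //=; rewrite yl // yu // ltnS; apply: h3.
by rewrite size_tuple.
Qed.

(** Strictness at the second and at the last but one point forces the first and last steps of both
    paths. *)
Lemma bounds_outline (P Q : N.+2.-tuple bool) r : bounds_diagram r P Q ->
  exists u v, P = lower v /\ Q = upper u.
Proof.
have split (w : N.+2.-tuple bool) : exists a (v : N.-tuple bool) b, w = [tuple of a :: rcons v b].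
  case: w => -[//|a w] sw; case/lastP: w sw => [//|w b] sw.
  have sw' : size w == N by move: sw; rewrite /= size_rcons.
  by exists a, (Tuple sw'), b; apply: val_inj.
have [p0 [v [p1 ->]]] := split P; have [q0 [u [q1 ->]]] := split Q.
have count_rcons b (w : N.-tuple bool) : count id (rcons w b) = count id w + b.
  by rewrite -cats1 count_cat /= addn0.
have full (w : N.-tuple bool) : ypos w N = count id w by rewrite /ypos take_oversize ?size_tuple.
case/and3P=> /eqP h1 /eqP h2 /forallP h.
have e1 : p0 + (count id v + p1) = r by rewrite -h1 /ypos take_oversize ?size_tuple //= count_rcons.
have e2 : q0 + (count id u + q1) = r by rewrite -h2 /ypos take_oversize ?size_tuple //= count_rcons.
have := h (@Ordinal N.+2 1 isT); rewrite /= !ypos_cons /ypos !take0 !addn0 => a1.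
have := h ord_max; rewrite /= !ypos_cons !ypos_rcons ?size_tuple // !full => a2.
have [-> -> -> ->] : [/\ p0 = false, p1 = true, q0 = true & q1 = false].
  by case: p0 p1 q0 q1 e1 e2 a1 a2 {h h1 h2} => -[] [] [] //=; split=> //; lia.
by exists u, v.
Qed.

Lemma lower_inj : injective lower.
Proof. by move=> v v' /(congr1 val) /= [] /rcons_inj[] /val_inj. Qed.
Lemma upper_inj : injective upper.
Proof. by move=> v v' /(congr1 val) /= [] /rcons_inj[] /val_inj. Qed.
End Outline.

Lemma sum_tuple_words n k (F : seq bool -> nat) :
  \sum_(w : n.-tuple bool | count id w == k) F w = \sum_(w <- words n k) F w.
Proof.
rewrite -(big_map (val : n.-tuple bool -> seq bool) (fun w => count id w == k) F) -big_filter.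
apply: perm_big; apply: uniq_perm; rewrite ?uniq_words ?filter_uniq //.
  by rewrite map_inj_uniq ?index_enum_uniq //; exact: val_inj.
move=> w; rewrite mem_filter mem_words andbC; congr (_ && _).
apply/mapP/eqP => [[t _ ->]|sw]; first by rewrite size_tuple.
by exists (Tuple (introT eqP sw)); rewrite ?mem_index_enum.
Qed.

Lemma ypos_inj n (P P' : n.-tuple bool) :
  (forall k, k <= n -> ypos P k = ypos P' k) -> P = P'.
Proof.
move=> h; apply: val_inj; apply: (@eq_from_nth _ false); first by rewrite !size_tuple.
move=> k; rewrite size_tuple => kn.
have := h _ kn; rewrite !yposS ?size_tuple // h ?(ltnW kn) // => /addnI.
by case: nth; case: nth.
Qed.

(** The squares with two corners on the antidiagonal x + y = k have heights from [ypos P k] to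
    [ypos Q k - 1]. This range is nonempty, so it determines its ends. *)
Lemma squares_ypos n r (P Q P' Q' : n.-tuple bool) :
    bounds_diagram r P Q -> bounds_diagram r P' Q' -> squares P Q = squares P' Q' ->
  forall k, k <= n -> ypos P' k <= ypos P k /\ ypos Q k <= ypos Q' k.
Proof.
case/and3P=> /eqP eP /eqP eQ /forallP b /and3P[/eqP eP' /eqP eQ' /forallP b'] s k.
rewrite leq_eqVlt => /orP[/eqP->|kn]; first by rewrite eP eQ eP' eQ'.
case: k kn => [|k] kn; first by rewrite /ypos !take0.
have {b}bk : ypos P k.+1 < ypos Q k.+1 := b (Ordinal kn).
have sub j : ypos P k.+1 <= j < ypos Q k.+1 -> ypos P' k.+1 <= j < ypos Q' k.+1.
  move=> /andP[j1 j2].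
  have kw w : size w = n -> xpos w k.+1 + ypos w k.+1 = k.+1 by move=> sw; apply: xyposD; rewrite sw ltnW.
  have xP := kw P (size_tuple _); have xP' := kw P' (size_tuple _); have xQ := kw Q (size_tuple _).
  have jk : j <= k by lia.
  have jn : j < n by lia.
  have in' : k - j < n by lia.
  have := congr1 (fun A : {set _} => (Ordinal in', Ordinal jn) \in A) s.
  rewrite !inE /= subnK //; lia.
have := sub (ypos P k.+1); have := sub (ypos Q k.+1).-1; lia.
Qed.

Lemma squares_inj n r (P Q P' Q' : n.-tuple bool) :
    bounds_diagram r P Q -> bounds_diagram r P' Q' -> squares P Q = squares P' Q' ->
  (P, Q) = (P', Q').
Proof.
move=> b b' s; have h := squares_ypos b b' s; have h' := squares_ypos b' b (esym s).
by congr (_, _); apply: ypos_inj => k kn; have [? ?] := h k kn; have [? ?] := h' k kn; lia.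
Qed.

(** [X] needs to be translated only for paths in the right position, and [X'] implies this position,
    so the final sum runs over all pairs of words with equal counts. *)
Lemma card_diagrams N r (X : N.+2.-tuple bool -> N.+2.-tuple bool -> bool)
    (X' : seq bool -> seq bool -> bool) :
    (forall u v : N.-tuple bool, count id u = count id v -> below u v ->
       X (lower v) (upper u) = X' u v) ->
    (forall u v : N.-tuple bool, count id u = count id v -> X' u v -> below u v) ->
  #|[set squares w.1 w.2 | w : N.+2.-tuple bool * N.+2.-tuple bool
      & bounds_diagram r w.1 w.2 && X w.1 w.2]|
  = if r is q.+1 then \sum_(u <- words N q) count (X' u) (words N q) else 0.
Proof.
move=> XX' bel.
rewrite card_in_imset; last first.
  by move=> [P Q] [P' Q']; rewrite !inE => /andP[/= b _] /andP[/= b' _] /=; exact: squares_inj b b'.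
pose f (p : N.-tuple bool * N.-tuple bool) := (lower p.2, upper p.1).
have finj : injective f.
  move=> [u v] [u' v'] e.
  by have /lower_inj/= -> := congr1 fst e; have /upper_inj/= -> := congr1 snd e.
case: r => [|q].
  apply: eq_card0 => -[P Q]; rewrite inE; apply/negP => /andP[/= b _].
  by have [u [v [eP eQ]]] := bounds_outline b; move: b; rewrite eP eQ => /bounds_lower_upper[].
rewrite (eq_card (B := [set f p | p in
   [set p : N.-tuple bool * N.-tuple bool | [&& count id p.1 == q, count id p.2 == q & X' p.1 p.2]]])); last first.
  move=> [P Q]; rewrite inE; apply/idP/imsetP => [/andP[/= b x]|[[u v]]].
    have [u [v [eP eQ]]] := bounds_outline b; move: b x; rewrite eP eQ.
    move=> /bounds_lower_upper[[cu] [cv] b x]; exists (u, v) => //.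
    by rewrite inE /= cu cv !eqxx -XX' // cu cv.
  rewrite inE => /and3P[/= /eqP cu /eqP cv x] [-> ->].
  have cuv : count id u = count id v by rewrite cu cv.
  apply/andP; split => /=; last by rewrite XX' //; exact: bel.
  by apply/bounds_lower_upper; rewrite cu cv; split=> //; exact: bel.
rewrite card_imset // cardsE -sum1_card -(pair_big_dep xpredT (fun u v : N.-tuple bool => [&& count id u == q, count id v == q & X' u v]) (fun _ _ => 1)) /=.
rewrite -sum_tuple_words [RHS]big_mkcond; apply: eq_bigr => u _.
case: eqP => _ /=; last by rewrite big_pred0.
rewrite big_mkcondr (sum_tuple_words _ _ (fun v => if X' u v then 1 else 0)) -big_mkcond.
exact: sum1_count.
Qed.

Lemma xpos_cons b w k : xpos (b :: w) k.+1 = ~~ b + xpos w k.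
Proof. by []. Qed.
Lemma xpos_rcons w b k : k <= size w -> xpos (rcons w b) k = xpos w k.
Proof. by move=> kw; rewrite /xpos -cats1 takel_cat. Qed.

Lemma xpos_negb w k : xpos (map negb w) k = ypos w k.
Proof. by rewrite /xpos /ypos -map_take count_map; apply: eq_count => -[]. Qed.
Lemma ypos_negb w k : ypos (map negb w) k = xpos w k.
Proof. by rewrite /xpos /ypos -map_take count_map. Qed.

Definition inner_strict (u v : seq bool) :=
  [/\ 0 < size u, nth false u 0 && ~~ nth false v 0, ~~ last true u && last false v
    & forall k, 0 < k < size u -> ypos v k < ypos u k].

Lemma tprim_inner u v : size u = size v -> count id u = count id v -> tprim u v -> inner_strict u v.
Proof.
move=> suv cuv t; have bel := tprim_below suv cuv t.
case/and5P: t => _ hu hv lu lv; split=> //; last by rewrite lu.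
  by case: (u) hu.
by case: (u) hu => [|[]] // ?; case: (v) hv => [|[]].
Qed.

(** Reflection in the diagonal exchanges the two kinds of steps and the roles of the words; it
    transfers the estimate for rows to columns. *)
Lemma inner_strict_negb u v : size u = size v ->
  inner_strict u v -> inner_strict (map negb v) (map negb u).
Proof.
move=> suv [u0 h l bel]; have v0 : 0 < size v by rewrite -suv.
split; rewrite ?size_map //.
- by rewrite !(nth_map false) // negbK andbC.
- case: (u) u0 l => // a u' _; case: (v) v0 => // b v' _ /=.
  by rewrite !last_map negbK andbC.
- move=> k /andP[k0 kv]; rewrite !ypos_negb.
  have ku : k < size u by rewrite suv.
  have := bel k; rewrite k0 ku => /(_ isT).
  have := xyposD (ltnW kv); have := xyposD (ltnW ku); lia.
Qed.

(** The two steps reach a common height. A gap of at most one would make [u] and [v] meet at their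
    [l]-th points, hence at an end; the conditions [Pk] and [Ql], with the prescribed first and last
    steps, exclude both ends. *)
Lemma row_gap u v k l (P := false :: rcons v true) (Q := true :: rcons u false) :
    size u = size v -> count id u = count id v -> inner_strict u v ->
    k < size P -> l < size Q ->
    0 < ypos P k.+1 -> ypos Q l < count id Q ->
    ypos P k <= ypos Q l.+1 -> ypos Q l <= ypos P k.+1 ->
  xpos Q l.+1 + 2 <= xpos P k.
Proof.
move=> suv cuv [u0 /andP[hu hv] /andP[lu lv] bel] kP lQ Pk Ql PQ QP.
have v0 : 0 < size v by rewrite -suv.
case: k kP Pk PQ QP => [|k] kP Pk PQ QP; first by move: Pk; rewrite /P ypos_cons /ypos take0.
have kv : k <= size v by move: kP; rewrite /= size_rcons.
have ku : k <= size u by rewrite suv.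
have lsu : l <= size u.
  move: lQ; rewrite /= size_rcons ltnS leq_eqVlt => /orP[/eqP e|//].
  by move: Ql; rewrite e ypos_cons ypos_rcons // ypos_size /= -cats1 count_cat /= !addn0 ltnn.
have lsv : l <= size v by rewrite -suv.
rewrite /P /Q !xpos_cons !xpos_rcons // add0n addn2 ltnS leqNgt; apply/negP => lt.
have {}lt : xpos v k <= xpos u l by rewrite -ltnS.
have lpos : 0 < l -> ypos Q l = (ypos u l.-1).+1.
  by case: l lsu {lsv lt lQ Ql PQ QP} => // l lsu _; rewrite /Q ypos_cons ypos_rcons // ltnW.
have ulast : ypos u (size u).-1 = count id u.
  have k1 : (size u).-1 < size u by rewrite prednK.
  have := yposS k1; rewrite prednK // ypos_size (set_nth_default true) // nth_last (negbTE lu); lia.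
have cQ : count id Q = (count id u).+1 by rewrite /Q /= -cats1 count_cat /= !addn0.
have meet : ypos u l = ypos v l -> l = 0 \/ l = size u.
  move=> e; have [|lN] := ltnP l (size u); last by right; lia.
  by case: (posnP l) => [->|l0 lN]; [left|have := bel l; rewrite l0 lN e ltnn => /(_ isT)].
have lN : l <> size u.
  by move=> e; move: Ql; rewrite lpos ?e // cQ ulast ltnn.
have bell : ypos v l <= ypos u l.
  have [->|l0] := posnP l; first by rewrite /ypos !take0.
  by apply/ltnW/bel; rewrite l0 /=; lia.
have xu := xyposD lsu; have xv := xyposD lsv.
have [lk|kl] := leqP l k.
  have xlk := @xpos_le v _ _ lk.
  have l0 : l = 0 by case: meet; lia.
  move: lt; rewrite l0 {2}/xpos take0 leqn0 => /eqP xk.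
  have k0 : k = 0.
    apply/eqP; rewrite -leqn0 leqNgt; apply/negP => k0.
    by have := @xpos_le v _ _ k0; rewrite xposS // xk (negbTE hv) addn1.
  by move: Pk; rewrite k0 /P ypos_cons ypos_rcons // yposS // /ypos take0 (negbTE hv).
have l0 : 0 < l by lia.
move: QP; rewrite lpos // /P ypos_cons add0n ypos_rcons; last by lia.
have := @ypos_le v k.+1 l kl.
have := @yposS u l.-1; rewrite prednK // => /(_ lsu); have := leq_b1 (nth false u l.-1).
by move=> h1 h2 h3 h4; case: meet; lia.
Qed.

(** * Thickness in the plane *)

Section Real.
Variable R : realType.
Import Order.TTheory GRing.Theory Num.Theory numFieldNormedType.Exports.
Local Open Scope ring_scope.

Lemma interior_box (A : set (R * R)) (z : R * R) : interior A z <->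
  exists2 e : R, 0 < e & forall z', `|z.1 - z'.1| < e -> `|z.2 - z'.2| < e -> A z'.
Proof.
split.
  move=> /nbhs_ballP[e /= e0 he]; exists e => // z' h1 h2; apply: he.
  by split; rewrite /ball /=.
case=> e e0 he; apply/nbhs_ballP; exists e => // z' [h1 h2]; exact: he.
Qed.

(** An interior point can be moved slightly to the lower left and to the upper right within the
    region, so it is not on the sides of the bounding box. *)
Lemma region_interior n (D : {set 'I_n * 'I_n}) (a b : nat) (z : R * R) :
    (forall c, c \in D -> ((c.1 : nat) < a) && ((c.2 : nat) < b))%N ->
    interior (region (R:=R) D) z -> 0 < z.1 < a%:R /\ 0 < z.2 < b%:R.
Proof.
move=> hab /interior_box[e e0 he].
have [c [cD c1 c2]] : region D (z.1 - e / 2, z.2 - e / 2).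
  by apply: he => /=; rewrite opprB addrC subrK gtr0_norm; lra.
have [d [dD d1 d2]] : region D (z.1 + e / 2, z.2 + e / 2).
  by apply: he => /=; rewrite opprD addrA subrr add0r normrN gtr0_norm; lra.
have /andP[da db] := hab _ dD.
have : ((d.1 : nat).+1%:R : R) <= a%:R by rewrite ler_nat.
have : ((d.2 : nat).+1%:R : R) <= b%:R by rewrite ler_nat.
have : (0 : R) <= (c.1 : nat)%:R by rewrite ler0n.
have : (0 : R) <= (c.2 : nat)%:R by rewrite ler0n.
move: c1 c2 d1 d2 => /= /andP[c1 _] /andP[c2 _] /andP[_ d1] /andP[_ d2].
by split; lra.
Qed.

Section Plane.
Variables (N : nat) (u v : N.-tuple bool).
Hypothesis cuv : count id u = count id v.
Let P := lower v.
Let Q := upper u.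

Let suv : size u = size v. Proof. by rewrite !size_tuple. Qed.

Lemma inner_strict_thick : inner_strict u v -> non_mixed P Q -> thick R P Q.
Proof.
move=> inner nm; split=> // p q [k [kP pk1 pk2]] [l [lQ ql1 ql2]] [t [t01 hz]].
have [cP ecP] : exists c, c = count negb P by eexists.
have [cQ ecQ] : exists c, c = count id Q by eexists.
have [|] := region_interior (a := cP) (b := cQ) _ hz.
  move=> c; rewrite inE ecP ecQ => /andP[c1 c2].
  rewrite (leq_trans c1) ?(leq_trans c2) //.
    by rewrite -[X in (_ <= count _ X)%N](cat_take_drop (c.1 + c.2).+1 Q) count_cat leq_addr.
  by rewrite -[X in (_ <= count _ X)%N](cat_take_drop (c.1 + c.2).+1 P) count_cat leq_addr.
move=> /= /andP[z1 z2] /andP[z3 z4].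
move: pk1 pk2 ql1 ql2 => /andP[p1 p2] /andP[p3 p4] /andP[q1 q2] /andP[q3 q4].
split=> e.
(* A horizontal segment has the height of the interior point that it meets, so this height is
   strictly between the bottom and the top. *)
- have zy : (1 - t) * p.2 + t * q.2 = p.2 by rewrite -e; ring.
  rewrite zy in z3 z4.
  have : (xpos Q l.+1 + 2 <= xpos P k)%N.
    apply: (@row_gap u v k l) => //; change (false :: rcons v true) with (tval P);
      change (true :: rcons u false) with (tval Q).
    + by rewrite -(ltr0n R); lra.
    + by rewrite -ecQ -(ltr_nat R); lra.
    + by rewrite -(ler_nat R); lra.
    + by rewrite -(ler_nat R); lra.
  rewrite -(ler_nat R) natrD => h.
  by rewrite ger0_norm; lra.
- have zx : (1 - t) * p.1 + t * q.1 = p.1 by rewrite -e; ring.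
  rewrite zx in z1 z2.
  (* Vertical segments: after reflection [Q] is the lower path and [P] the upper one. *)
  have eQ : false :: rcons (map negb u) true = map negb Q by rewrite /= map_rcons.
  have eP : true :: rcons (map negb v) false = map negb P by rewrite /= map_rcons.
  have := @row_gap (map negb v) (map negb u) l k.
  cbv zeta; rewrite eP eQ !size_map !ypos_negb !xpos_negb.
  move=> /(_ (esym suv)) gap.
  have {gap} : (ypos P k.+1 + 2 <= ypos Q l)%N.
    apply: gap => //; last 4 first.
    + by rewrite -(ltr0n R); lra.
    + by rewrite count_map -[count _ _]/(count negb P) -ecP -(ltr_nat R); lra.
    + by rewrite -(ler_nat R); lra.
    + by rewrite -(ler_nat R); lra.
    + by rewrite !count_map -!/(count negb _) !count_negb suv cuv.
    + exact: inner_strict_negb.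
  rewrite -(ler_nat R) natrD => h.
  by rewrite ler0_norm; lra.
Qed.

Lemma mem_squares i j :
  (i + j <= N)%N -> (i < xpos P (i + j).+1)%N -> (j < ypos Q (i + j).+1)%N ->
  exists2 c, c \in squares P Q & (c.1 : nat) = i /\ (c.2 : nat) = j.
Proof.
move=> ij hi hj.
have li : (i < N.+2)%N by lia.
have lj : (j < N.+2)%N by lia.
by exists (Ordinal li, Ordinal lj) => //; rewrite inE /= hi hj.
Qed.

Lemma mem_region i j (z : R * R) :
  (i + j <= N)%N -> (i < xpos P (i + j).+1)%N -> (j < ypos Q (i + j).+1)%N ->
  i%:R <= z.1 <= i%:R + 1 -> j%:R <= z.2 <= j%:R + 1 -> region (squares P Q) z.
Proof.
move=> ij hi hj z1 z2; have [c cD [c1 c2]] := mem_squares ij hi hj.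
by exists c; rewrite c1 c2 -!natr1.
Qed.

Lemma xpos_lower k : (k <= N)%N -> xpos P k.+1 = (xpos v k).+1.
Proof. by move=> kN; rewrite /P xpos_cons xpos_rcons ?size_tuple. Qed.
Lemma ypos_lower k : (k <= N)%N -> ypos P k.+1 = ypos v k.
Proof. by move=> kN; rewrite /P ypos_cons ypos_rcons ?size_tuple. Qed.
Lemma xpos_upper k : (k <= N)%N -> xpos Q k.+1 = xpos u k.
Proof. by move=> kN; rewrite /Q xpos_cons xpos_rcons ?size_tuple. Qed.
Lemma ypos_upper k : (k <= N)%N -> ypos Q k.+1 = (ypos u k).+1.
Proof. by move=> kN; rewrite /Q ypos_cons ypos_rcons ?size_tuple. Qed.

(** A common step N at (x, y) puts the squares (x, y) and (x, y + 1) in the diagram, with [P] along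
    a right side and [Q] along a left side. Their common side joins the paths, has length 1 and has
    its midpoint in the interior. For a step E the two squares are side by side. *)
Lemma thick_no_common : thick R P Q -> no_common_step u v.
Proof.
case=> _ th k ku e; apply/eqP => eb.
have kN : (k < N)%N by rewrite -(size_tuple u).
have kv : (k < size v)%N by rewrite -suv.
have ex : xpos u k = xpos v k.
  by have := xyposD (ltnW ku); have := xyposD (ltnW kv); lia.
have sP : size P = N.+2 by rewrite size_tuple.
have sQ : size Q = N.+2 by rewrite size_tuple.
have xP := xpos_lower (ltnW kN); have xP' := xpos_lower kN.
have yP := ypos_lower (ltnW kN); have yP' := ypos_lower kN.
have xQ := xpos_upper (ltnW kN); have xQ' := xpos_upper kN.
have yQ := ypos_upper (ltnW kN); have yQ' := ypos_upper kN.
have xy : (xpos v k + ypos v k)%N = k by apply/xyposD/ltnW.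
rewrite (xposS kv) in xP'; rewrite (yposS kv) in yP'.
rewrite (xposS ku) eb ex in xQ'; rewrite (yposS ku) eb e in yQ'.
rewrite ex in xQ; rewrite e in yQ.
move: (xpos v k) (ypos v k) xP xP' yP yP' xQ xQ' yQ yQ' xy {ex e} => x y xP xP' yP yP' xQ xQ' yQ yQ' xy.
have cell0 : (x + y <= N)%N /\ (x < xpos P (x + y).+1)%N /\ (y < ypos Q (x + y).+1)%N.
  by rewrite xy xP yQ; lia.
case: cell0 => c1 [c2 c3].
case b : (nth false v k) xP' yP' xQ' yQ' => /=.
- rewrite ?addn0 ?addn1 => xP' yP' xQ' yQ'.
  have [c4 [c5 c6]] : (x + y.+1 <= N)%N /\ (x < xpos P (x + y.+1).+1)%N
      /\ (y.+1 < ypos Q (x + y.+1).+1)%N.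
    by rewrite addnS xy xP' yQ'; lia.
  (* The first point ends the step of [P], the second begins the step of [Q]. *)
  have [|||/(_ erefl) + _] := th (x%:R + 1, y%:R + 1) (x%:R, y%:R + 1).
  + exists k.+1; rewrite sP xP xP' yP yP' -!natr1 /=.
    by split; [lia|lra|lra].
  + exists k.+1; rewrite sQ xQ xQ' yQ yQ' -!natr1 /=.
    by split; [lia|lra|lra].
  + exists (1 / 2); split; first by lra.
    apply/interior_box; exists (1 / 2); first by lra.
    move=> [z1 z2] /=; rewrite !ltr_norml => /andP[h1 h2] /andP[h3 h4].
    have [le|lt] := lerP z2 (y%:R + 1).
      by apply: (mem_region c1 c2 c3) => /=; lra.
    by apply: (mem_region c4 c5 c6) => /=; rewrite -?natr1; lra.
  + by rewrite /= ger0_norm; lra.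
- rewrite ?addn0 ?addn1 => xP' yP' xQ' yQ'.
  have [c4 [c5 c6]] : (x.+1 + y <= N)%N /\ (x.+1 < xpos P (x.+1 + y).+1)%N
      /\ (y < ypos Q (x.+1 + y).+1)%N.
    by rewrite addSn xy xP' yQ'; lia.
  have [|||_ /(_ erefl)] := th (x%:R + 1, y%:R) (x%:R + 1, y%:R + 1).
  + exists k.+1; rewrite sP xP xP' yP yP' -!natr1 /=.
    by split; [lia|lra|lra].
  + exists k.+1; rewrite sQ xQ xQ' yQ yQ' -!natr1 /=.
    by split; [lia|lra|lra].
  + exists (1 / 2); split; first by lra.
    apply/interior_box; exists (1 / 2); first by lra.
    move=> [z1 z2] /=; rewrite !ltr_norml => /andP[h1 h2] /andP[h3 h4].
    have [le|lt] := lerP z1 (x%:R + 1).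
      by apply: (mem_region c1 c2 c3) => /=; lra.
    by apply: (mem_region c4 c5 c6) => /=; rewrite -?natr1; lra.
  + by rewrite /= ler0_norm; lra.
Qed.

(** With empty inner words the diagram is a single square, crossed by a segment of length 1. *)
Lemma thick_length : thick R P Q -> (0 < N)%N.
Proof.
case=> _ th; rewrite lt0n; apply/eqP => N0.
have u0 : (u : seq bool) = [::] by apply/size0nil; rewrite size_tuple.
have v0 : (v : seq bool) = [::] by apply/size0nil; rewrite size_tuple.
have eP : (P : seq bool) = [:: false; true] by rewrite /P /= v0.
have eQ : (Q : seq bool) = [:: true; false] by rewrite /Q /= u0.
have [|||/(_ erefl) + _] := th (1, 1 / 2) (0, 1 / 2).
+ by exists 1%N; rewrite eP; split=> //=; rewrite /xpos /ypos /=; lra.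
+ by exists 0%N; rewrite eQ; split=> //=; rewrite /xpos /ypos /=; lra.
+ exists (1 / 2); split; first by lra.
  apply/interior_box; exists (1 / 2); first by lra.
  move=> [z1 z2] /=; rewrite !ltr_norml => /andP[h1 h2] /andP[h3 h4].
  apply: (@mem_region 0 0); rewrite ?eP ?eQ //=; lra.
+ by rewrite /= subr0 normr1; lra.
Qed.

Lemma thickP : below u v -> thick R P Q <-> tprim u v.
Proof.
move=> bel; split=> [th|tp].
  apply: no_common_tprim => //; first by rewrite size_tuple; exact: thick_length.
    by apply: below_apart_good => //; rewrite -non_mixed_apart; case: th.
  exact: thick_no_common.
apply: inner_strict_thick; first exact: tprim_inner.
by rewrite non_mixed_apart; apply/good_apart/sgood_good; case/and5P: tp.
Qed.

End Plane.
End Real.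

(** * Order-consecutive partitions *)

Definition zero_gaps (w : nat -> nat) i j := forall g, i <= g -> g.+1 < j -> w g = 0.

(* The block of label [c] surrounds the interval [[x, y[ in [[i, j[.  A gap next to
   a block lying on both sides weighs 1, and on one side only it weighs 2. *)
Definition shell (L : eqType) (f : nat -> L) (w : nat -> nat) i x y j (c : L) :=
  [/\ [/\ i <= x, x < y, y <= j & (i < x) || (y < j)],
      forall a, (i <= a < x) || (y <= a < j) -> f a = c,
      forall a, x <= a < y -> f a <> c,
      zero_gaps w i x /\ zero_gaps w y j
    & (i < x -> w x.-1 = if y < j then 1 else 2) /\
      (y < j -> w y.-1 = if i < x then 1 else 2)].

(** The core is the first part of an admissible order and each layer is the next part; the last
    index counts the parts. The weights are independent data, so that a labelling can also be built
    from given weights. *)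
Inductive layered (L : eqType) (f : nat -> L) (w : nat -> nat) : nat -> nat -> nat -> Prop :=
| Core i j c : i < j -> (forall a, i <= a < j -> f a = c) -> zero_gaps w i j ->
    layered f w i j 1
| Layer i x y j k c : shell f w i x y j c -> layered f w x y k -> layered f w i j k.+1.

Lemma layered_lt (L : eqType) (f : nat -> L) w i j k : layered f w i j k -> i < j.
Proof. by case=> {i j k} // i x y j k c [[ix xy yj _] _ _ _ _] _; lia. Qed.

Lemma layered_pos (L : eqType) (f : nat -> L) w i j k : layered f w i j k -> 0 < k.
Proof. by case. Qed.

Lemma layered_weight (L : eqType) (f : nat -> L) w w' i j k :
  (forall g, i <= g -> g.+1 < j -> w g = w' g) -> layered f w i j k -> layered f w' i j k.
Proof.
move=> + h; elim: h => {i j k} [i j c ij fc z e|i x y j k c [[ix xy yj ne] fc fn [z1 z2] [e1 e2]] _ IH e].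
  by apply: Core fc _ => // g ig gj; rewrite -e // z.
apply: (@Layer _ _ _ _ x y _ _ c) (IH _); last by move=> g gx gy; apply: e; lia.
split=> //; split.
- by move=> g ig gx; rewrite -e ?z1 //; lia.
- by move=> g ig gx; rewrite -e ?z2 //; lia.
- by move=> ix'; rewrite -e ?e1 //; lia.
- by move=> yj'; rewrite -e ?e2 //; lia.
Qed.

(** Used to pass between numbers and blocks as labels. *)
Lemma layered_pattern (L L' : eqType) (f : nat -> L) (f' : nat -> L') w i j k :
    (forall a b, i <= a < j -> i <= b < j -> (f a == f b) = (f' a == f' b)) ->
  layered f w i j k -> layered f' w i j k.
Proof.
move=> + h; elim: h => {i j k} [i j c ij fc z e|i x y j k c [[ix xy yj ne] fc fn z12 e12] _ IH e].
  apply: (@Core _ _ _ _ _ (f' i)) => // a aij.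
  by apply/eqP; rewrite -e ?fc //; lia.
have [d ho] : exists d, (i <= d < x) || (y <= d < j).
  by case/orP: ne => h; [exists i|exists y]; lia.
apply: (@Layer _ _ _ _ x y _ _ (f' d)) (IH _); last by move=> a b ha hb; apply: e; lia.
split=> //.
  by move=> a ha; apply/eqP; rewrite -e ?(fc a) ?(fc d) //; lia.
by move=> a ha /eqP; rewrite -e ?(fc d) //; [move/eqP; exact: fn|lia|lia].
Qed.

(** * The gap weights of a labelling *)

Section Cut.
Variables (L : eqType) (f : nat -> L) (M : nat).

Definition fresh g := all (fun a => f a != f g.+1) (iota 0 g.+1).
Definition ended g := all (fun b => f b != f g) (iota g.+1 (M - g.+1)).
Definition cut g : nat := fresh g + ended g.

Lemma freshP g : reflect (forall a, a <= g -> f a <> f g.+1) (fresh g).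
Proof.
apply: (iffP allP) => h a ag; first by apply/eqP/h; rewrite mem_iota.
by apply/eqP/h; move: ag; rewrite mem_iota; lia.
Qed.

Lemma endedP g : reflect (forall b, g < b < M -> f b <> f g) (ended g).
Proof.
apply: (iffP allP) => h a ag; first by apply/eqP/h; rewrite mem_iota; lia.
by apply/eqP/h; move: ag; rewrite mem_iota; lia.
Qed.

Lemma cut_same g : g.+1 < M -> f g = f g.+1 -> cut g = 0.
Proof.
move=> gM e; have /negbTE nf : ~~ fresh g by apply/negP => /freshP/(_ g (leqnn g)).
have /negbTE ne : ~~ ended g by apply/negP => /endedP/(_ g.+1); rewrite ltnSn gM => /(_ isT); rewrite e.
by rewrite /cut nf ne.
Qed.

(** [cut] inspects all of [0, M[ while a layering sees only its own interval; the two agree if no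
    label inside the interval occurs outside. *)
Definition closed_block i j :=
  forall a b, i <= a < j -> b < M -> ~~ (i <= b < j) -> f a <> f b.

Lemma closed_inner i x y j c : i <= x -> y <= j ->
  (forall a, (i <= a < x) || (y <= a < j) -> f a = c) ->
  (forall a, x <= a < y -> f a <> c) -> closed_block i j -> closed_block x y.
Proof.
move=> ix yj fc fn cl a b axy bM nb e.
have [h|h] := boolP (i <= b < j); last by apply: (cl a b) => //; lia.
by apply: (fn a axy); rewrite e fc //; lia.
Qed.

Lemma cut_const i j c : j <= M -> (forall a, i <= a < j -> f a = c) -> zero_gaps cut i j.
Proof. by move=> jM fc g ig gj; apply: cut_same; rewrite ?fc //; lia. Qed.

(** At the gap before [x] a part begins, and at the gap after [y.-1] a part ends. Each weight gets a
    second unit unless the surrounding part occurs on the other side too. *)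
Lemma cut_shell i x y j c : i <= x -> x < y -> y <= j -> (i < x) || (y < j) -> j <= M ->
  (forall a, (i <= a < x) || (y <= a < j) -> f a = c) ->
  (forall a, x <= a < y -> f a <> c) -> closed_block i j -> shell f cut i x y j c.
Proof.
move=> ix xy yj ne jM fc fn cl; split=> //.
  split; first by apply: (@cut_const i x c) => [|a ha]; [|apply: fc]; lia.
  by apply: (@cut_const y j c) => [|a ha]; [|apply: fc]; lia.
have other a b : x <= a < y -> b < M -> ~~ (x <= b < y) -> f a <> f b.
  by move=> ha bM hb; apply: (closed_inner ix yj fc fn cl).
split=> h.
- have e : x.-1.+1 = x by lia.
  have fr : fresh x.-1.
    by apply/freshP => a ax /esym; rewrite e; apply: other; lia.
  rewrite /cut fr; case: ifP => h'.
    suff -> : ended x.-1 = false by [].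
    apply/negbTE/negP => /endedP/(_ y); rewrite !fc; try lia.
    by move=> k; apply: k => //; lia.
  suff -> : ended x.-1 by [].
  apply/endedP => b bM; rewrite [f x.-1]fc; last lia.
  have [hb|hb] := boolP (x <= b < y); first exact: fn.
  move=> fb; apply: (cl x.-1 b); try lia.
  by rewrite fb fc //; lia.
- have e : y.-1.+1 = y by lia.
  have en : ended y.-1.
    by apply/endedP => b bM /esym; apply: other; lia.
  rewrite /cut en addnC; case: ifP => h'.
    suff -> : fresh y.-1 = false by [].
    apply/negbTE/negP => /freshP/(_ i); rewrite e !fc; try lia.
    by move=> k; apply: k => //; lia.
  suff -> : fresh y.-1 by [].
  apply/freshP => a ay; rewrite e [f y]fc; last lia.
  have [hb|hb] := boolP (x <= a < y); first exact: fn.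
  move=> fb; apply: (cl y a); try lia.
  by rewrite fb fc //; lia.
Qed.

Lemma layered_cut w i j k : j <= M -> closed_block i j -> layered f w i j k ->
  forall g, i <= g -> g.+1 < j -> w g = cut g.
Proof.
move=> + + h; elim: h => {i j k} [i j c ij fc z jM cl g ig gj|i x y j k c sh _ IH jM cl g ig gj].
  by rewrite z // (cut_const jM fc).
have [[ix xy yj ne] fc fn [z1 z2] [e1 e2]] := sh.
have [_ _ _ [z1' z2'] [e1' e2']] := cut_shell ix xy yj ne jM fc fn cl.
have [h|h|h] := ltngtP g.+1 x.
- by rewrite z1 ?z1'.
- have [h'|h'|h'] := ltngtP g.+1 y.
  + apply: IH => //; first lia.
    exact: closed_inner fc fn cl.
  + by rewrite z2 ?z2'.
  + by rewrite -h' /= in e2 e2'; rewrite e2 // e2'.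
- by rewrite -h /= in e1 e1'; rewrite e1 // e1'.
Qed.
End Cut.

Lemma sum_gaps (w : nat -> nat) i x j : i < x -> x < j ->
  \sum_(i <= g < j.-1) w g =
    \sum_(i <= g < x.-1) w g + w x.-1 + \sum_(x <= g < j.-1) w g.
Proof.
move=> ix xj; rewrite (@big_cat_nat _ _ _ x.-1) /=; [|lia|lia].
by rewrite [X in _ + X]big_ltn; last lia; rewrite prednK ?addnA //; lia.
Qed.

Lemma sum_zero_gaps w i j : zero_gaps w i j -> \sum_(i <= g < j.-1) w g = 0.
Proof. by move=> z; rewrite big_nat_cond big1 // => g /andP[/andP[? ?] _]; apply: z; lia. Qed.

(** A layer adds two gaps of weight 1 or a single gap of weight 2. *)
Lemma sum_shell (L : eqType) (f : nat -> L) w i x y j c : shell f w i x y j c ->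
  \sum_(i <= g < j.-1) w g = \sum_(x <= g < y.-1) w g + 2.
Proof.
case=> -[ix xy yj ne] _ _ [z1 z2] [e1 e2].
move: ix yj; rewrite [i <= x]leq_eqVlt [y <= j]leq_eqVlt => /predU1P[ix|ix] /predU1P[yj|yj].
- by move: ne; rewrite ix yj !ltnn.
- by subst i; rewrite (@sum_gaps _ _ y _) // (sum_zero_gaps z2) e2 // ltnn addn0.
- by subst j; rewrite (@sum_gaps _ _ x _) // (sum_zero_gaps z1) e1 // ltnn add0n addnC.
- rewrite (@sum_gaps _ _ x _) //; last lia.
  by rewrite [X in _ + _ + X](@sum_gaps _ _ y _) // (sum_zero_gaps z1) (sum_zero_gaps z2) e1 // e2 // ix yj; lia.
Qed.

Lemma layered_sum (L : eqType) (f : nat -> L) w i j k : layered f w i j k ->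
  \sum_(i <= g < j.-1) w g = k.-1.*2.
Proof.
elim=> {i j k} [i j c _ _ z|i x y j k c sh lay IH]; first exact: sum_zero_gaps.
by rewrite (sum_shell sh) IH; have := layered_pos lay; lia.
Qed.

(** * Recovering the outer part from the weights *)

Section Inversion.
Variables (L : eqType) (f : nat -> L) (w : nat -> nat).

Lemma layered_zero i j k : layered f w i j k -> zero_gaps w i j ->
  exists c, forall a, i <= a < j -> f a = c.
Proof.
case=> {i j k} [i j c _ fc _ _|i x y j k c [[ix xy yj ne] _ _ _ [e1 e2]] _ z]; first by exists c.
case/orP: ne => h.
  by have := e1 h; rewrite z //; [case: ifP|lia|lia].
by have := e2 h; rewrite z //; [case: ifP|lia|lia].
Qed.

(* The layers can be reordered so that the first block comes last. *)
Lemma layered_left i x j k : layered f w i j k -> i < x -> x < j ->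
    zero_gaps w i x -> w x.-1 = 2 ->
  exists c k', shell f w i x j j c /\ layered f w x j k'.
Proof.
move=> h; elim: h x => {i j k} [i j c ij fc z|i x0 y j k c sh lay IH] x ix xj zx wx.
  by move: wx; rewrite z //; lia.
have [[ix0 xy yj ne] fc fn [z1 z2] [e1 e2]] := sh.
have [lt|] := ltnP i x0.
  have ex : x0 = x.
    apply/eqP; rewrite eqn_leq; apply/andP; split; rewrite leqNgt; apply/negP => h.
      by move: wx; rewrite z1 //; lia.
    by have := e1 lt; rewrite zx; [case: ifP|lia|lia].
  subst x0; have := e1 lt; rewrite wx; case: ifP => // yj' _.
  have ey : y = j by lia.
  by subst y; exists c, k.
move=> h; have {h} ei : x0 = i by lia.
subst x0; have yj' : y < j by move: ne; rewrite ltnn.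
have := e2 yj'; rewrite ltnn => wy.
have [xy'|yx|ey] := ltngtP x y.
- have [c' [k' [[_ fc' fn' [z1' _] [e1' _]] lay']]] := IH x ix xy' zx wx.
  exists c', k'.+1; split.
    have fcc : c <> c' by move=> e; apply: (fn i); rewrite ?ix //= ?e ?fc' //; lia.
    split; rewrite ?ltnn ?leqnn //.
    + by split=> //; [exact: ltnW|lia].
    + by move=> a ha; apply: fc'; lia.
    + move=> a ha; have [ay|ya] := ltnP a y; first by apply: fn'; lia.
      by rewrite fc //; lia.
    + by split=> // g g1 g2; lia.
  apply: (@Layer _ _ _ _ x y _ _ c) lay'; split=> //.
  + by split=> //; lia.
  + by move=> a ha; apply: fc; lia.
  + by move=> a ha; apply: fn; lia.
  + by split=> // g g1 g2; lia.
  + by rewrite ltnn; split=> // h; lia.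
- by move: wy; rewrite zx //; lia.
- subst y; have [c' fc'] := layered_zero lay zx.
  exists c', 1; split; last first.
    by apply: (@Core _ _ _ _ _ c) => // a ha; apply: fc; lia.
  have fcc : c <> c' by move=> e; apply: (fn i); rewrite ?ix //= ?e ?fc' //; lia.
  split; rewrite ?ltnn //.
  + by split=> //; lia.
  + by move=> a ha; apply: fc'; lia.
  + by move=> a ha; rewrite fc //; lia.
  + by split=> // g g1 g2; lia.
Qed.

Lemma layered_right i y j k : layered f w i j k -> i < y -> y < j ->
    zero_gaps w y j -> w y.-1 = 2 ->
  exists c k', shell f w i i y j c /\ layered f w i y k'.
Proof.
move=> h; elim: h y => {i j k} [i j c ij fc z|i x y0 j k c sh lay IH] y iy yj zy wy.
  by move: wy; rewrite z //; lia.
have [[ix xy yj0 ne] fc fn [z1 z2] [e1 e2]] := sh.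
have [lt|] := ltnP y0 j.
  have ey : y0 = y.
    apply/eqP; rewrite eqn_leq; apply/andP; split; rewrite leqNgt; apply/negP => h.
      by have := e2 lt; rewrite zy; [case: ifP|lia|lia].
    by move: wy; rewrite z2 //; lia.
  subst y0; have := e2 lt; rewrite wy; case: ifP => // ix' _.
  have ex : x = i by lia.
  by subst x; exists c, k.
move=> h; have {h} ej : y0 = j by lia.
subst y0; have ix' : i < x by move: ne; rewrite ltnn orbF.
have := e1 ix'; rewrite ltnn => wx.
have [yx|xy'|ey] := ltngtP y x.
- by move: wx; rewrite zy //; lia.
- have [c' [k' [[_ fc' fn' [_ z2'] [_ e2']] lay']]] := IH y xy' yj zy wy.
  exists c', k'.+1; split.
    have fcc : c <> c' by move=> e; apply: (fn y); rewrite ?e ?fc' //; lia.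
    split; rewrite ?ltnn ?leqnn //.
    + by split; lia.
    + by move=> a ha; apply: fc'; lia.
    + move=> a ha; have [ay|ya] := ltnP a x; last by apply: fn'; lia.
      by rewrite fc //; lia.
    + by split=> // g g1 g2; lia.
  apply: (@Layer _ _ _ _ x y _ _ c) lay'; split=> //.
  + by split=> //; lia.
  + by move=> a ha; apply: fc; lia.
  + by move=> a ha; apply: fn; lia.
  + by split=> // g g1 g2; lia.
  + by rewrite ltnn; split=> // h; lia.
(* The layers inside are a single block here: it becomes the outer part, and the former outer part
   becomes the core. *)
- subst y; have [c' fc'] := layered_zero lay zy.
  exists c', 1; split; last first.
    by apply: (@Core _ _ _ _ _ c) => // a ha; apply: fc; lia.
  have fcc : c <> c' by move=> e; apply: (fn x); rewrite ?e ?fc' //; lia.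
  split; rewrite ?ltnn //.
  + by split=> //; lia.
  + by move=> a ha; apply: fc'; lia.
  + by move=> a ha; rewrite fc //; lia.
  + by split=> // g g1 g2; lia.
Qed.

Lemma layered_both i x y j k : layered f w i j k -> i < x -> x < y -> y < j ->
    zero_gaps w i x -> zero_gaps w y j -> w x.-1 = 1 -> w y.-1 = 1 ->
  exists c k', shell f w i x y j c /\ layered f w x y k'.
Proof.
case=> {i j k} [i j c ij fc z|i x0 y0 j k c sh lay] ix xy yj zx zy wx wy.
  by move: wx; rewrite z //; lia.
have [[ix0 xy0 yj0 ne] fc fn [z1 z2] [e1 e2]] := sh.
have [lx|] := ltnP i x0; last first.
  move=> h; have {h} ei : x0 = i by lia.
  subst x0; have yj' : y0 < j by move: ne; rewrite ltnn.
  have := e2 yj'; rewrite ltnn => wy0.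
  have [yy|yy|ey] := ltngtP y y0.
  - by move: wy0; rewrite zy //; lia.
  - by move: wy; rewrite z2 //; lia.
  - by move: wy0; rewrite -ey wy.
have ex : x0 = x.
  apply/eqP; rewrite eqn_leq; apply/andP; split; rewrite leqNgt; apply/negP => h.
    by move: wx; rewrite z1 //; lia.
  by have := e1 lx; rewrite zx; [case: ifP|lia|lia].
subst x0; have := e1 lx; rewrite wx; case: ifP => // ly _.
have ey : y0 = y.
  apply/eqP; rewrite eqn_leq; apply/andP; split; rewrite leqNgt; apply/negP => h.
    by have := e2 ly; rewrite zy; [case: ifP|lia|lia].
  by move: wy; rewrite z2 //; lia.
by subst y0; exists c, k.
Qed.
End Inversion.

(** The outer shell of one layering is visible in the weights, so the other layering can be
    rearranged to have the same shell, and induction applies inside. *)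
Lemma layered_unique (L L' : eqType) (f : nat -> L) (f' : nat -> L') w i j k k' :
    layered f w i j k -> layered f' w i j k' ->
  forall a b, i <= a < j -> i <= b < j -> (f a == f b) = (f' a == f' b).
Proof.
move=> h; elim: h k' => {i j k} [i j c ij fc z|i x y j k c sh lay IH] k' h' a b ha hb.
  by have [c' fc'] := layered_zero h' z; rewrite !fc // !fc' // !eqxx.
have [[ix xy yj ne] fc fn [z1 z2] [e1 e2]] := sh.
have [c' [k1 [[_ fc' fn' _ _] lay']]] :
    exists c' k1, shell f' w i x y j c' /\ layered f' w x y k1.
  move: ix yj; rewrite [i <= x]leq_eqVlt [y <= j]leq_eqVlt => /predU1P[ix|ix] /predU1P[yj|yj].
  - by move: ne; rewrite ix yj !ltnn.
  - by subst i; apply: layered_right h' _ _ _ _ => //; rewrite e2 // ltnn.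
  - by subst j; apply: layered_left h' _ _ _ _ => //; rewrite e1 // ltnn.
  - by apply: layered_both h' _ _ _ _ _ _ _ => //; rewrite ?e1 ?e2 // ?ix ?yj.
have [oa|na] := boolP ((i <= a < x) || (y <= a < j)); have [ob|nb] := boolP ((i <= b < x) || (y <= b < j)).
- by rewrite !fc // !fc' // !eqxx.
- rewrite (fc a) // (fc' a) //; transitivity false.
    by apply/eqP => /esym; apply: fn; lia.
  by symmetry; apply/eqP => /esym; apply: fn'; lia.
- rewrite (fc b) // (fc' b) //; transitivity false.
    by apply/eqP; apply: fn; lia.
  by symmetry; apply/eqP; apply: fn'; lia.
- by apply: (IH _ lay'); lia.
Qed.

Lemma layered_add (f : nat -> nat) w i x y j k :
    i <= x -> x < y -> y <= j -> (i < x) || (y < j) ->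
    zero_gaps w i x -> zero_gaps w y j ->
    (i < x -> w x.-1 = if y < j then 1 else 2) ->
    (y < j -> w y.-1 = if i < x then 1 else 2) ->
  layered f w x y k -> exists (f' : nat -> nat) k', layered f' w i j k'.
Proof.
move=> ix xy yj ne z1 z2 e1 e2 lay.
(* Raising the inner labels by one makes 0 a new label for the outer part. *)
exists (fun a => if x <= a < y then (f a).+1 else 0), k.+1.
apply: (@Layer _ _ _ _ x y _ _ 0).
  split=> // a ha; last by rewrite ha.
  by case: ifP => //; lia.
by apply: layered_pattern lay => a b ha hb; rewrite ha hb eqSS.
Qed.

(** If the first or the last nonzero weight is 2, a one-sided part is peeled off there. Otherwise
    both are 1, parity makes them distinct, and a two-sided part is peeled off. *)
Lemma layered_exists w i j : i < j -> (forall g, i <= g -> g.+1 < j -> w g <= 2) ->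
    ~~ odd (\sum_(i <= g < j.-1) w g) ->
  exists (f : nat -> nat) k, layered f w i j k.
Proof.
have [n] := ubnP (j - i); elim: n i j => // n IH i j jin ij w2 ev.
pose p g := [&& i <= g, g.+1 < j & w g != 0].
have [/hasP[g0 _ pg0]|z] := boolP (has p (iota 0 j)); last first.
  exists (fun=> 0), 1; apply: (@Core _ _ _ _ _ 0) => // g ig gj.
  apply/eqP; have /hasPn/(_ g) := z; rewrite mem_iota /p ig gj /= negbK; apply; lia.
have ex_p : exists g, p g by exists g0.
have ub_p g : p g -> g <= j by case/and3P; lia.
case: (ex_minnP ex_p) => g1 /and3P[ig1 g1j wg1] min1.
case: (ex_maxnP ex_p ub_p) => g2 /and3P[ig2 g2j wg2] max2.
have z1 : zero_gaps w i g1.+1.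
  move=> g ig gg; apply/eqP/negPn/negP => wg.
  by have := min1 g; rewrite /p ig wg andbT /=; lia.
have z2 : zero_gaps w g2.+1 j.
  move=> g ig gg; apply/eqP/negPn/negP => wg.
  by have := max2 g; rewrite /p gg wg andbT /=; lia.
have {min1} g12 : g1 <= g2 by apply: min1; rewrite /p ig2 g2j.
have b1 := w2 g1 ig1 g1j; have b2 := w2 g2 ig2 g2j.
have [e1|n1] := eqVneq (w g1) 2.
  have [||||f [k lay]] := IH g1.+1 j; try lia.
  - by move=> g ? ?; apply: w2; lia.
  - move: ev; rewrite (@sum_gaps _ _ g1.+1) ?(sum_zero_gaps z1) //=.
    by rewrite add0n oddD e1.
  apply: layered_add lay => //; rewrite ?ltnn //; try lia.
  by move=> g ? ?; lia.
have [e2|n2] := eqVneq (w g2) 2.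
  have [||||f [k lay]] := IH i g2.+1; try lia.
  - by move=> g ? ?; apply: w2; lia.
  - move: ev; rewrite (@sum_gaps _ _ g2.+1) ?(sum_zero_gaps z2) //=.
    by rewrite addn0 oddD e2 addbF.
  apply: layered_add lay => //; rewrite ?ltnn //; try lia.
  by move=> g ? ?; lia.
have {b1 n1} e1 : w g1 = 1 by lia.
have {b2 n2} e2 : w g2 = 1 by lia.
have [eg|ng] := eqVneq g1 g2.
  move: ev; rewrite (@sum_gaps _ _ g1.+1) ?(sum_zero_gaps z1) //=.
  by rewrite [X in _ + X](sum_zero_gaps (j := j)) ?e1 // eg.
have gg : g1 < g2 by lia.
have [||||f [k lay]] := IH g1.+1 g2.+1; try lia.
- by move=> g ? ?; apply: w2; lia.
- move: ev; rewrite (@sum_gaps _ _ g1.+1) ?(sum_zero_gaps z1) //=.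
  rewrite (@sum_gaps _ g1.+1 g2.+1) ?(sum_zero_gaps z2) //=.
  by rewrite add0n addn0 e1 e2 !oddD /=; case: odd.
apply: layered_add lay => //; try lia.
- by move=> _; rewrite /= e1 ifT.
- by move=> _; rewrite /= e2 ifT.
Qed.

Definition ternary n s := #|[set w : n.-tuple 'I_3 | sumn (map val w) == s]|.

Lemma ternary_trinomial n s : ternary n s = trinomial n s.
Proof.
elim: n s => [|n IH] s; rewrite /ternary.
  by rewrite (card_tuple0 (fun w : seq 'I_3 => sumn (map val w) == s)) /= eq_sym.
rewrite (card_tupleS _ (fun w : seq 'I_3 => sumn (map val w) == s)).
rewrite !big_ord_recl big_ord0 addn0 addnA /=.
have shift k : #|[set w : n.-tuple 'I_3 | k + sumn (map val w) == s]| =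
    if k <= s then trinomial n (s - k) else 0.
  case: ifP => ks.
    rewrite -IH; apply: eq_card => w; rewrite !inE; apply/eqP/eqP; lia.
  by rewrite cardsE; apply: eq_card0 => w; rewrite inE; apply/eqP; lia.
rewrite !shift /bump /= subn0.
by case: s {shift} => [|[|s]] //=; rewrite ?subn1 ?subn2 ?subSS ?subn0.
Qed.

(** * Partitions as labellings *)

Section Partitions.
Variable n : nat.
Implicit Types (S : {set {set 'I_n.+1}}) (A : {set 'I_n.+1}) (r : seq {set 'I_n.+1}).

Definition seg i j : {set 'I_n.+1} := [set a : 'I_n.+1 | i <= a < j].
(** The blocks themselves serve as labels. Beyond [n] the value is that of a default element, whence
    the bounds on positions in the statements. *)
Definition lab S (a : nat) := finset.pblock S (inord a).
Notation union r := (\bigcup_(A <- r) A)%SET.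

Lemma mem_union r a : (a \in union r) = has (fun A => a \in A) r.
Proof.
elim: r => [|A r IH]; first by rewrite big_nil finset.in_set0.
by rewrite big_cons finset.in_setU IH.
Qed.

Lemma interval_seg i j : interval_set (seg i j).
Proof.
apply/forall_inP => a; rewrite inE => ha; apply/forall_inP => b; rewrite inE => hb.
by apply/forallP => c; apply/implyP => hc; rewrite inE; lia.
Qed.

Lemma interval_setP A : interval_set A -> A != finset.set0 ->
  exists i j, [/\ i < j, j <= n.+1 & A = seg i j].
Proof.
move=> /forall_inP iA /finset.set0Pn[a aA].
case: (arg_minnP val aA) => /= i Ai mini; case: (arg_maxnP val aA) => /= j Aj maxj.
exists i, j.+1; split; [exact: (mini _ Aj)|exact: ltn_ord|].
apply/finset.setP => b; rewrite inE; apply/idP/idP => [bA|ibj].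
  by rewrite ltnS mini // maxj.
by move/forall_inP: (iA _ Ai) => /(_ _ Aj)/forallP/(_ b)/implyP; apply.
Qed.

Section Blocks.
Variable S : {set {set 'I_n.+1}}.
Hypothesis pS : finset.partition S [set: 'I_n.+1]%SET.

Lemma cover_all a : a \in finset.cover S.
Proof. by case/and3P: pS => /eqP -> _ _; rewrite finset.in_setT. Qed.

Lemma pblock_block A a : A \in S -> a \in A -> finset.pblock S a = A.
Proof. by case/and3P: pS => _ tS _; exact: def_pblock. Qed.

Lemma mem_pblock_eq a b : (a \in finset.pblock S b) = (finset.pblock S a == finset.pblock S b).
Proof. by case/and3P: pS => _ tS _; rewrite eq_sym eq_pblock // cover_all. Qed.

Lemma mem_lab (a : 'I_n.+1) b : (a \in lab S b) = (lab S a == lab S b).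
Proof. by rewrite /lab inord_val mem_pblock_eq. Qed.

Lemma lab_in b : lab S b \in S.
Proof. by rewrite /lab pblock_mem // cover_all. Qed.

Lemma lab_block A a : A \in S -> a < n.+1 -> (inord a \in A) = (lab S a == A).
Proof.
move=> AS an; apply/idP/eqP => [|<-]; first exact: pblock_block.
by rewrite /lab mem_pblock cover_all.
Qed.

Lemma closed_union r i j : {subset r <= S} -> union r = seg i j -> j <= n.+1 ->
  closed_block (lab S) n.+1 i j.
Proof.
move=> rS e jn a b aij bn nb eab.
have an : a < n.+1 by lia.
have : inord a \in union r by rewrite e inE inordK.
rewrite mem_union => /hasP[A Ar]; rewrite lab_block ?rS // eab -lab_block ?rS // => bA.
have : inord b \in union r by rewrite mem_union; apply/hasP; exists A.
by rewrite e inE inordK // (negbTE nb).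
Qed.

(** When the next part joins an interval of earlier parts and the union is again an interval, this
    part is exactly what is added on the two sides, so it is a layer. *)
Lemma order_consecutive_layered : order_consecutive S ->
  layered (lab S) (cut (lab S) n.+1) 0 n.+1 #|S|.
Proof.
case/existsP=> s /andP[ps /forallP int].
have us : uniq s by rewrite (perm_uniq ps) enum_uniq.
have sS A : (A \in (s : seq _)) = (A \in S) by rewrite (perm_mem ps) mem_enum.
have S0 : 0 < #|S| by apply/card_gt0P; exists (lab S 0); exact: lab_in.
have nonempty A : A \in S -> A != finset.set0.
  by case/and3P: pS => _ _ n0 AS; apply: contraNneq n0 => <-.
have lay l : l < #|S| -> exists i j, [/\ j <= n.+1, union (take l.+1 s) = seg i j &
    layered (lab S) (cut (lab S) n.+1) i j l.+1].
  elim: l => [|l IH] lS.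
    have s0 : 0 < size s by rewrite size_tuple.
    have e : take 1 s = [:: nth finset.set0 s 0] by rewrite (take_nth finset.set0 s0) take0.
    set A := nth _ s 0 in e; have AS : A \in S by rewrite -sS mem_nth.
    have := int (Ordinal lS); rewrite /= e big_seq1 => /interval_setP/(_ (nonempty _ AS)).
    case=> i [j [ij jn eA]]; exists i, j; split=> //.
    have fc a : i <= a < j -> lab S a = A.
      move=> h; have an : a < n.+1 by lia.
      by apply/eqP; rewrite -(lab_block AS an) eA inE inordK.
    by apply: (@Core _ _ _ _ _ A) => //; apply: cut_const fc.
  have [i [j [jn eu lay]]] := IH (ltnW lS).
  have sl : l.+1 < size s by rewrite size_tuple.
  set A := nth finset.set0 s l.+1.
  have AS : A \in S by rewrite -sS mem_nth.
  have et : take l.+2 s = rcons (take l.+1 s) A by rewrite (take_nth finset.set0 sl).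
  have Anew : A \notin take l.+1 s.
    have := take_uniq l.+2 us; rewrite et rcons_uniq => /andP[]; by [].
  have e2 : union (take l.+2 s) = (seg i j :|: A)%SET.
    by rewrite et -cats1 big_cat big_seq1 /= eu.
  have ij := layered_lt lay.
  have ein : inord i \in seg i j by rewrite inE inordK; lia.
  have := int (Ordinal lS); rewrite [take _ _]/= e2 => /interval_setP[].
    by apply/finset.set0Pn; exists (inord i); rewrite finset.in_setU ein.
  move=> i' [j' [ij' jn' e']]; rewrite e' in e2; exists i', j'; split=> //.
  have mA a : a < n.+1 -> (i' <= a < j') = (i <= a < j) || (lab S a == A).
    move=> an; move/(congr1 (fun B : {set _} => inord a \in B)): e'.
    by rewrite finset.in_setU !inE inordK // lab_block.
  have nA a : i <= a < j -> lab S a <> A.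
    move=> aij /eqP; rewrite -lab_block //; last lia.
    move=> aA; have an : a < n.+1 by lia.
    have : inord a \in union (take l.+1 s) by rewrite eu inE inordK.
    rewrite mem_union => /hasP[B Bt aB]; case/negP: Anew.
    by rewrite -(pblock_block AS aA) (pblock_block _ aB) // -sS (mem_take Bt).
  have ii : i' <= i.
    by have := mA i; rewrite leqnn ij => /(_ (leq_trans ij jn)) /andP[].
  have jj : j <= j'.
    have hj : i <= j.-1 < j by lia.
    have jn1 : j.-1 < n.+1 by lia.
    by have := mA _ jn1; rewrite hj => /andP[_]; lia.
  apply: (@Layer _ _ _ _ i j _ _ A) lay.
  apply: cut_shell => //.
  - have /finset.set0Pn[a aA] := nonempty _ AS.
    have la : lab S a = A by rewrite /lab inord_val; apply: pblock_block.
    have := mA a (ltn_ord a); rewrite la eqxx orbT.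
    have : ~~ (i <= a < j) by apply/negP => /nA; rewrite la.
    by move: (nat_of_ord a) => b; lia.
  - by move=> a ha; have := mA a; case: eqP => // _; lia.
  - by apply: (@closed_union (take l.+2 s)) => // B /mem_take; rewrite sS.
have [|i [j [jn eu lay']]] := lay #|S|.-1; first by rewrite prednK.
rewrite prednK // in eu lay'.
have full a : a < n.+1 -> i <= a < j.
  move=> an; have : inord a \in union (take #|S| s).
    rewrite mem_union take_oversize ?size_tuple //; apply/hasP; exists (lab S a).
      by rewrite sS lab_in.
    by rewrite lab_block ?lab_in.
  by rewrite eu inE inordK.
have i0 : i = 0 by have := full 0; lia.
have jn1 : j = n.+1 by have := full n; lia.
by rewrite i0 jn1 in lay'.
Qed.

(** Reading the parts from the core outwards gives an admissible order. *)
Lemma layered_sequence w i j k : layered (lab S) w i j k -> j <= n.+1 ->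
    closed_block (lab S) n.+1 i j ->
  exists s, [/\ size s = k, uniq s, {subset s <= S}, union s = seg i j
              & forall l, 0 < l <= k -> interval_set (union (take l s))].
Proof.
elim=> {i j k} [i j c ij fc z|i x y j k c sh lay IH] jn cl.
  exists [:: lab S i]; have e : lab S i = seg i j.
    apply/finset.setP => a; rewrite inE mem_lab; apply/eqP/idP => [e|h].
      by apply/negPn/negP => na; apply: (cl i a); rewrite ?leqnn ?ij.
    by rewrite !fc // leqnn.
  split=> //; first by move=> A; rewrite inE => /eqP->; exact: lab_in.
  - by rewrite big_seq1.
  - by case=> [|[|l]] //= _; rewrite big_seq1 e interval_seg.
have [[ix xy yj ne] fc fn _ _] := sh.
have [||s [ss us sS eu int]] := IH; [lia|exact: closed_inner fc fn cl|].
have [d [ho oij]] : exists d, ((i <= d < x) || (y <= d < j)) /\ i <= d < j.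
  by case/orP: ne => h; [exists i|exists y]; lia.
have co : lab S d = c by apply: fc.
have mc (a : 'I_n.+1) : (a \in c) = (i <= a < x) || (y <= a < j).
  rewrite -co mem_lab; apply/eqP/idP => [e|h]; last by rewrite !fc.
  have [h|h] := boolP (i <= a < j); last by case: (cl d a).
  by apply/negPn/negP => h'; apply: (fn a); [lia|rewrite e].
have e : union (rcons s c) = seg i j.
  rewrite -cats1 big_cat big_seq1 /= eu; apply/finset.setP => a.
  by rewrite finset.in_setU mc !inE; lia.
exists (rcons s c); split.
- by rewrite size_rcons ss.
- rewrite rcons_uniq us andbT; apply/negP => cs.
  have : inord d \in union s.
    by rewrite mem_union; apply/hasP; exists c; rewrite // mc inordK //; lia.
  by rewrite eu inE inordK; lia.
- move=> A; rewrite mem_rcons inE => /predU1P[->|]; last exact: sS.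
  by rewrite -co lab_in.
- exact: e.
- move=> l /andP[l0]; rewrite leq_eqVlt => /predU1P[->|lk].
    by rewrite take_oversize ?size_rcons ?ss // e interval_seg.
  by rewrite -cats1 takel_cat ?ss // int // l0.
Qed.

Lemma layered_order_consecutive w k : layered (lab S) w 0 n.+1 k ->
  #|S| = k /\ order_consecutive S.
Proof.
move=> lay; have [//||s [ss us sS eu int]] := layered_sequence lay.
  by move=> a b _ bn /negP[].
have pe : perm_eq s (enum S).
  apply: uniq_perm; rewrite ?enum_uniq // => A; rewrite mem_enum.
  apply/idP/idP => [/sS//|AS].
  have /finset.set0Pn[a aA] : A != finset.set0.
    by case/and3P: pS => _ _ n0; apply: contraNneq n0 => <-.
  have : a \in union s by rewrite eu inE ltn_ord.
  rewrite mem_union => /hasP[B Bs aB].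
  by rewrite -(pblock_block AS aA) (pblock_block (sS _ Bs) aB).
have sk : size s = #|S| by rewrite (perm_size pe) cardE.
split; first by rewrite -sk.
apply/existsP; exists (tcast sk (in_tuple s)); rewrite val_tcast pe /=.
by apply/forallP => l; apply: int; rewrite -ss sk /=.
Qed.
End Blocks.

Lemma partition_inj S S' :
    finset.partition S [set: 'I_n.+1]%SET -> finset.partition S' [set: 'I_n.+1]%SET ->
    (forall a b, a < n.+1 -> b < n.+1 -> (lab S a == lab S b) = (lab S' a == lab S' b)) ->
  {subset S <= S'}.
Proof.
move=> pS pS' h A AS.
have /finset.set0Pn[a aA] : A != finset.set0.
  by case/and3P: pS => _ _ n0; apply: contraNneq n0 => <-.
suff -> : A = lab S' a by apply: lab_in.
apply/finset.setP => b; rewrite mem_lab // -h ?ltn_ord //.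
by rewrite /lab !inord_val (pblock_block pS AS aA) -(pblock_block pS AS aA) mem_pblock_eq.
Qed.

Definition gap_word S : n.-tuple 'I_3 := [tuple inord (cut (lab S) n.+1 g) | g < n].

Lemma cut_le2 (L : eqType) (f : nat -> L) M g : cut f M g < 3.
Proof. by rewrite /cut; case: fresh; case: ended. Qed.

Lemma gap_word_sum S : sumn (map val (gap_word S)) = \sum_(0 <= g < n) cut (lab S) n.+1 g.
Proof.
rewrite sumnE big_map big_tuple big_mkord; apply: eq_bigr => g _.
by rewrite tnth_mktuple /= inordK // cut_le2.
Qed.

(** The gap word is injective by [layered_unique]. A word with the right sum comes from the
    labelling of [layered_exists], whose fibres form a partition with that gap word by
    [layered_cut]. *)
Lemma card_order_consecutive (r : nat) : #|order_consecutive_partitions n.+1 r| =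
  if r is q.+1 then ternary n q.*2 else 0.
Proof.
have layer S : S \in order_consecutive_partitions n.+1 r ->
    finset.partition S [set: 'I_n.+1]%SET /\ layered (lab S) (cut (lab S) n.+1) 0 n.+1 r.
  rewrite inE => /and3P[pS /eqP <- oc]; split=> //.
  exact: order_consecutive_layered.
case: r layer => [|q] layer.
  by apply: eq_card0 => S; apply/negP => /layer[_ /layered_pos].
rewrite -(card_in_imset (f := gap_word)).
  apply: eq_card => w; rewrite inE; apply/imsetP/eqP => [[S /layer[pS lay] ->]|sw].
    by rewrite gap_word_sum (layered_sum lay).
  pose v g := val (nth ord0 w g).
  have sv : \sum_(0 <= g < n) v g = q.*2.
    rewrite big_mkord -sw sumnE big_map big_tuple; apply: eq_bigr => g _.
    by rewrite (tnth_nth ord0).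
  have [||f [k lay]] := @layered_exists v 0 n.+1 isT.
  - by move=> g _ _; rewrite -ltnS /v ltn_ord.
  - by rewrite sv odd_double.
  pose S := preim_partition (fun a : 'I_n.+1 => f a) [set: 'I_n.+1]%SET.
  have pS : finset.partition S [set: 'I_n.+1]%SET by exact: preim_partitionP.
  have pat a b : a < n.+1 -> b < n.+1 -> (f a == f b) = (lab S a == lab S b).
    move=> an bn; rewrite -(mem_pblock_eq pS).
    rewrite pblock_equivalence_partition ?finset.in_setT //; last by split=> // /eqP->.
    by rewrite /= !inordK // eq_sym.
  have layS : layered (lab S) v 0 n.+1 k.
    by apply: layered_pattern lay => a b /andP[_ ?] /andP[_ ?]; exact: pat.
  have [cS oc] := layered_order_consecutive pS layS.
  (* [layered_exists] leaves the number of parts open; the sum of the weights determines it. *)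
  have kq : k = q.+1.
    have := layered_sum layS; rewrite /= sv; have := layered_pos layS; lia.
  exists S; first by rewrite inE pS cS kq eqxx.
  apply: eq_from_tnth => g; rewrite tnth_mktuple.
  have cl : closed_block (lab S) n.+1 0 n.+1 by move=> a b _ bn /negP[].
  rewrite -(layered_cut (leqnn _) cl layS (leq0n g)) ?ltnS //.
  by apply: val_inj; rewrite (tnth_nth ord0) /v /= inordK.
move=> S S' /layer[pS lay] /layer[pS' lay'] e.
have eg g : g < n -> cut (lab S') n.+1 g = cut (lab S) n.+1 g.
  move=> gn; have := congr1 (fun t => val (tnth t (Ordinal gn))) e.
  by rewrite !tnth_mktuple /= !inordK ?cut_le2.
have h := layered_unique lay (layered_weight (fun g _ (gn : g.+1 < n.+1) => eg g gn) lay').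
apply/finset.setP => A; apply/idP/idP; apply: partition_inj => // a b an bn.
by rewrite h.
Qed.
End Partitions.

Lemma sum_tprim N q : \sum_(u <- words N q) count (tprim u) (words N q) =
  if (N, q) is (N'.+1, q'.+1) then tpairs N' q' else 0.
Proof.
have starts (u v : seq bool) : tprim u v -> ohead u = Some true /\ ohead v = Some false.
  by case/and5P=> _ /eqP-> /eqP->.
case: N => [|N].
  rewrite big_seq big1 // => u; rewrite mem_words => /andP[/nilP-> _].
  by apply: count_words0 => v _; apply/negP => /starts[].
rewrite sum_wordsS [X in X + _]big1 ?add0n => [|u _]; last first.
  by apply: count_words0 => v _; apply/negP => /starts[].
case: q => // q; apply: eq_bigr => u _.
rewrite count_wordsS [X in _ + X]count_words0 ?addn0 => [|v _]; first exact: eq_count.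
by apply/negP => /starts[].
Qed.

Lemma delannoy_neg (i j : int) : (i < 0)%R || (j < 0)%R -> delannoy i j = 0.
Proof. by case: i => i; case: j => j. Qed.

Theorem theorem5p6 (R : realType) (m r : nat) (hm : (0 < m)%N) :
  #|thick_diagrams R m r| =
    delannoy (m%:Z - r%:Z - 1)%R (r%:Z - 2)%R /\
  #|non_mixed_diagrams m r| = #|order_consecutive_partitions m r|.
Proof.
(* The outer steps take two of the [m + 1] steps, so the inner words have length [N = m - 1]. *)
case: m hm => // N _; split; last first.
  rewrite (@card_diagrams N r (fun P Q => non_mixed P Q) good).
  - rewrite card_order_consecutive; case: r => // q.
    by rewrite ternary_trinomial -npairs_trinomial.
  - move=> u v cuv bel; rewrite non_mixed_apart; apply/idP/idP; last exact: good_apart.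
    by move=> ap; apply: (below_apart_good _ bel ap); rewrite !size_tuple.
  - by move=> u v cuv g; apply: (good_below _ cuv g); rewrite !size_tuple.
rewrite (@card_diagrams N r (fun P Q => `[< thick R P Q >]) tprim).
- case: r => [|q]; first by rewrite delannoy_neg // orbT.
  rewrite sum_tprim; case: q => [|q]; first by case: N => [|N]; rewrite delannoy_neg // orbT.
  have -> : (q.+2%:Z - 2 = q%:Z)%R by lia.
  case: N => [|N]; first by rewrite delannoy_neg //; lia.
  have [Nq|qN] := leqP N q; first by rewrite tpairs_gt // delannoy_neg //; lia.
  (* Now [m = N.+2] and [r = q.+2]: without its forced first step each inner word has length
     [m - 2], and the upper one keeps [r - 2] steps N. *)
  have -> : (N.+2%:Z - q.+2%:Z - 1 = (N - q.+1)%N%:Z)%R by lia.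
  have {1}-> : N = (N - q.+1 + q).+1 by lia.
  exact: tpairs_delannoy.
- move=> u v cuv bel; apply/asboolP/idP => h; exact/(thickP R cuv bel).
- move=> u v cuv tp; apply: (good_below _ cuv); first by rewrite !size_tuple.
  by apply: sgood_good; case/and5P: tp.
Qed.
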